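(* Assume that $q$ is not a root of unity. Then the elements $\Omega^\ell\alpha^r\beta^s\gamma^t$ with $\ell,r,s,t\geq 0$ form a basis for the $\mathbb F$-vector space $Z(\Delta)$, the center of $\Delta$.
   Context: Let $\mathbb F$ be a field and fix a nonzero $q\in\mathbb F$ with $q^4\neq 1$. The universal Askey--Wilson algebra $\Delta$ is the associative $\mathbb F$-algebra with 1 with generators $A,B,C$ subject to the relations that each of $A+\frac{qBC-q^{-1}CB}{q^2-q^{-2}}$, $B+\frac{qCA-q^{-1}AC}{q^2-q^{-2}}$, $C+\frac{qAB-q^{-1}BA}{q^2-q^{-2}}$ is central; $\alpha,\beta,\gamma$ denote these three central elements (in order) each multiplied by $q+q^{-1}$. Let $\Omega = qABC+q^2A^2+q^{-2}B^2+q^2C^2-qA\alpha-q^{-1}B\beta-qC\gamma$. *)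

(* Defs.v *)
From HB Require Import structures.
From mathcomp Require Import all_boot all_order all_algebra.
Set Implicit Arguments. Unset Strict Implicit. Unset Printing Implicit Defensive.
Import GRing.Theory.
Local Open Scope ring_scope.

Definition AW_XA (F : fieldType) (R : algType F) (q : F) (a b c : R) : R :=
  a + (q ^+ 2 - q ^- 2)^-1 *: (q *: (b * c) - q^-1 *: (c * b)).

(* (a,b,c) satisfy the defining relations of the universal Askey--Wilson
   algebra: each of X_A, X_B, X_C commutes with each generator
   (equivalently: is central in the algebra generated by a, b, c). *)
Definition AW_rel (F : fieldType) (R : algType F) (q : F) (a b c : R) : Prop :=
  let xa := AW_XA q a b c in
  let xb := AW_XA q b c a in
  let xc := AW_XA q c a b in
  forall x y, x \in [:: xa; xb; xc] -> y \in [:: a; b; c] -> x * y = y * x.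

Definition is_alg_hom (F : fieldType) (D R : algType F) (f : D -> R) : Prop :=
  [/\ forall x y, f (x + y) = f x + f y,
      forall x y, f (x * y) = f x * f y,
      f 1 = 1 &
      forall (k : F) x, f (k *: x) = k *: f x].

(* (D; A, B, C) is the universal Askey--Wilson algebra Delta: the relations
   hold in D, and D is initial among F-algebras with three elements
   satisfying the relations (i.e. D is presented by generators A, B, C
   and these relations). *)
Definition is_universal_AW (F : fieldType) (q : F) (D : algType F) (A B C : D) : Prop :=
  AW_rel q A B C /\
  forall (R : algType F) (a b c : R), AW_rel q a b c ->
    (exists f : D -> R, is_alg_hom f /\ f A = a /\ f B = b /\ f C = c) /\
    (forall f g : D -> R, is_alg_hom f -> is_alg_hom g ->
       f A = g A -> f B = g B -> f C = g C -> forall x, f x = g x).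

Definition AW_alpha (F : fieldType) (D : algType F) (q : F) (A B C : D) : D :=
  (q + q^-1) *: AW_XA q A B C.
Definition AW_beta (F : fieldType) (D : algType F) (q : F) (A B C : D) : D :=
  (q + q^-1) *: AW_XA q B C A.
Definition AW_gamma (F : fieldType) (D : algType F) (q : F) (A B C : D) : D :=
  (q + q^-1) *: AW_XA q C A B.

Definition AW_Omega (F : fieldType) (D : algType F) (q : F) (A B C : D) : D :=
  q *: (A * B * C) + q ^+ 2 *: (A ^+ 2) + q ^- 2 *: (B ^+ 2) + q ^+ 2 *: (C ^+ 2)
  - q *: (A * AW_alpha q A B C) - q^-1 *: (B * AW_beta q A B C)
  - q *: (C * AW_gamma q A B C).

Definition AW_mon (F : fieldType) (D : algType F) (q : F) (A B C : D)
  (i : nat * nat * nat * nat) : D :=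
  let: (l, r, s, t) := i in
  AW_Omega q A B C ^+ l * AW_alpha q A B C ^+ r * AW_beta q A B C ^+ s
  * AW_gamma q A B C ^+ t.

Definition central (R : ringType) (z : R) : Prop := forall x : R, z * x = x * z.

(* Main.v *)
Require Import Defs.
From HB Require Import structures.
From mathcomp Require Import all_boot all_order all_algebra.
From mathcomp Require Import boolp.
From mathcomp Require Import ring zify.
Import GRing.Theory.
Local Open Scope ring_scope.

Set Implicit Arguments.
Unset Strict Implicit.
Unset Printing Implicit Defensive.

#[local] Obligation Tactic := idtac.

(** Order the monomials A^i B^j C^k alpha^r beta^s gamma^t (PBW monomials) by the
    degree i + j + k.  The relations show that they span Delta and that, up to
    terms of lower degree, the generators commute up to powers of q.  Their
    linear independence is seen in a representation by difference operators
    over a field of rational functions, whose parameters are powers of a single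
    variable chosen so that distinct monomials get distinct leading exponents.
    If z is central, comparing top degrees in z A = A z and z C = C z, with q not
    a root of unity, leaves only exponents i = j = k in its top part; as the
    leading term of Omega^l is a multiple of A^l B^l C^l, subtracting a
    combination of the Omega^l alpha^r beta^s gamma^t lowers the degree. *)

(** * Linear operators on two-sided sequences *)

Section Operators.

Variables (F K : fieldType) (iota : {rmorphism F -> K}).

Definition op_linear (f : (int -> K) -> int -> K) : Prop :=
  forall (a : K) v w n, f (fun m => a * v m + w m) n = a * f v n + f w n.

Lemma op_linear_scale f k v n : op_linear f -> f (fun m => k * v m) n = k * f v n.
Proof.
move=> lf; have f0 : f (fun=> 0) n = 0.
  have := lf 1 (fun=> 0) (fun=> 0) n.
  rewrite !mul1r addr0 => /esym/eqP.
  by rewrite -subr_eq0 addrK => /eqP.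
have := lf k v (fun=> 0) n; rewrite f0 addr0 => <-.
by congr f; apply/funext => m; rewrite addr0.
Qed.

Definition op of {rmorphism F -> K} := {f : (int -> K) -> int -> K | op_linear f}.
Local Notation opT := (op iota).

Definition op_fun (x : opT) : (int -> K) -> int -> K := sval x.
Local Coercion op_fun : op >-> Funclass.

Lemma opP (x y : opT) : (forall v n, x v n = y v n) -> x = y.
Proof.
case: x y => [f lf] [g lg] /= h.
have e : f = g by apply/funext => v; apply/funext => n; apply: h.
by case: _ / e lg {h} => lg; congr exist; exact: Prop_irrelevance.
Qed.

HB.instance Definition _ := gen_eqMixin opT.
HB.instance Definition _ := gen_choiceMixin opT.

Program Definition op_zero : opT := exist _ (fun _ _ => 0) _.
Next Obligation. by move=> a v w n; rewrite mulr0 addr0. Qed.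
Program Definition op_add (x y : opT) : opT := exist _ (fun v n => x v n + y v n) _.
Next Obligation.
by move=> [f lf] [g lg] a v w n; rewrite /op_fun /= lf lg; ring.
Qed.
Program Definition op_opp (x : opT) : opT := exist _ (fun v n => - x v n) _.
Next Obligation. by move=> [f lf] a v w n; rewrite /op_fun /= lf; ring. Qed.
Program Definition op_one : opT := exist _ (fun v n => v n) _.
Next Obligation. by move=> a v w n. Qed.
Program Definition op_mul (x y : opT) : opT := exist _ (fun v n => x (y v) n) _.
Next Obligation.
move=> [f lf] [g lg] a v w n; rewrite /op_fun /=.
by rewrite -lf; congr f; apply/funext => m; rewrite lg.
Qed.
Program Definition op_scale (k : F) (x : opT) : opT :=
  exist _ (fun v n => iota k * x v n) _.
Next Obligation. by move=> k [f lf] a v w n; rewrite /op_fun /= lf; ring. Qed.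

Lemma op_addA : associative op_add.
Proof. by move=> x y z; apply: opP => v n; rewrite /= addrA. Qed.
Lemma op_addC : commutative op_add.
Proof. by move=> x y; apply: opP => v n; rewrite /= addrC. Qed.
Lemma op_add0 : left_id op_zero op_add.
Proof. by move=> x; apply: opP => v n; rewrite /= add0r. Qed.
Lemma op_addN : left_inverse op_zero op_opp op_add.
Proof. by move=> x; apply: opP => v n; rewrite /= addNr. Qed.

HB.instance Definition _ := GRing.isZmodule.Build opT op_addA op_addC op_add0 op_addN.

Lemma op_mulA : associative op_mul.
Proof. by move=> x y z; apply: opP => v n. Qed.
Lemma op_mul1l : left_id op_one op_mul.
Proof. by move=> x; apply: opP => v n. Qed.
Lemma op_mul1r : right_id op_one op_mul.
Proof. by move=> x; apply: opP => v n. Qed.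
Lemma op_mulDl : left_distributive op_mul op_add.
Proof. by move=> x y z; apply: opP => v n. Qed.
Lemma op_mulDr : right_distributive op_mul op_add.
Proof.
move=> [f lf] y z; apply: opP => v n; rewrite /op_fun /=.
have := lf 1 (y v) (z v) n; rewrite mul1r => <-.
by congr f; apply/funext => m; rewrite mul1r.
Qed.
Lemma op_one_neq0 : op_one != op_zero.
Proof.
apply/eqP => /(congr1 (fun x : opT => x (fun=> 1) 0)) /= /eqP.
by rewrite /op_fun /= oner_eq0.
Qed.

HB.instance Definition _ := GRing.Zmodule_isNzRing.Build opT
  op_mulA op_mul1l op_mul1r op_mulDl op_mulDr op_one_neq0.

Lemma op_scaleA a b (x : opT) : op_scale a (op_scale b x) = op_scale (a * b) x.
Proof. by apply: opP => v n; rewrite /op_fun /= rmorphM mulrA. Qed.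
Lemma op_scale1 : left_id 1 op_scale.
Proof. by move=> x; apply: opP => v n; rewrite /op_fun /= rmorph1 mul1r. Qed.
Lemma op_scaleDr : right_distributive op_scale +%R.
Proof. by move=> a x y; apply: opP => v n; rewrite /op_fun /= mulrDr. Qed.
Lemma op_scaleDl (x : opT) : {morph op_scale^~ x : a b / a + b}.
Proof. by move=> a b; apply: opP => v n; rewrite /op_fun /= rmorphD mulrDl. Qed.

HB.instance Definition _ := GRing.Zmodule_isLmodule.Build F opT
  op_scaleA op_scale1 op_scaleDr op_scaleDl.

Lemma op_scaleAl a (x y : opT) : a *: (x * y) = (a *: x) * y.
Proof. by apply: opP => v n. Qed.

HB.instance Definition _ := GRing.Lmodule_isLalgebra.Build F opT op_scaleAl.

Lemma op_scaleAr a (x y : opT) : a *: (x * y) = x * (a *: y).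
Proof.
by case: x => f lf; apply: opP => v n; rewrite /op_fun /= op_linear_scale.
Qed.

HB.instance Definition _ := GRing.Lalgebra_isAlgebra.Build F opT op_scaleAr.

End Operators.

(** * A representation of the Askey--Wilson relations *)

Section QuantumParameter.

Variables (F : fieldType) (q : F).
Hypothesis q4 : q ^+ 4 != 1.

Lemma q2D1_neq0 : q * q + 1 != 0.
Proof.
apply: contra q4 => /eqP h; rewrite -subr_eq0.
have -> : q ^+ 4 - 1 = (q * q + 1) * (q ^+ 2 - 1) by ring.
by rewrite h mul0r.
Qed.

Lemma q4B1_neq0 : (q * q) ^+ 2 - 1 != 0.
Proof. by rewrite subr_eq0 -expr2 -exprM. Qed.

End QuantumParameter.

Section Representation.

Variables (F K : fieldType) (iota : {rmorphism F -> K}).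
Local Notation opT := (op iota).
Local Coercion op_fun : op >-> Funclass.

Program Definition op_scalar (k : K) : opT := exist _ (fun v n => k * v n) _.
Next Obligation. by move=> k a v w n /=; ring. Qed.

Lemma op_scalar_comm k (x : opT) : op_scalar k * x = x * op_scalar k.
Proof.
by case: x => f lf; apply: opP => v n; rewrite /op_fun /= op_linear_scale.
Qed.

Variables (q : F) (b tau e f g : K).
Let Q := iota q.

Definition tau_at (n : int) : K := tau * Q ^ (- (2 * n)).
Definition phi_at (x : K) : K :=
  Q ^+ 2 * b * x ^+ 2 + e * x + (g - b - b^-1) + f / (b * x)
  + 1 / (Q ^+ 2 * b * x ^+ 2).

(* With S the shift, t the multiplication by [tau_at] (so S t = q^-2 t S) and
   b, e, f, g central, these are A = S + t + t^-1, B = b t + (b t)^-1 + phi S^-1 and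
   the C that makes the third relation hold with gamma = g. *)
Program Definition rep_A : opT :=
  exist _ (fun v n => v (n + 1) + (tau_at n + (tau_at n)^-1) * v n) _.
Next Obligation. by move=> a v w n /=; ring. Qed.
Program Definition rep_B : opT :=
  exist _ (fun v n => (b * tau_at n + (b * tau_at n)^-1) * v n
                      + phi_at (tau_at n) * v (n - 1)) _.
Next Obligation. by move=> a v w n /=; ring. Qed.
Program Definition rep_C : opT :=
  exist _ (fun v n => - (Q / (b * tau_at n)) * v (n + 1)
     - (Q * f / (b * tau_at n) + (Q + Q^-1) / (b * tau_at n ^+ 2)) * v n
     - phi_at (tau_at n) / (Q * tau_at n) * v (n - 1)) _.
Next Obligation. by move=> a v w n /=; ring. Qed.

Hypotheses (q0 : q != 0) (q4 : q ^+ 4 != 1) (b0 : b != 0) (tau0 : tau != 0).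

Let Q0 : Q != 0. Proof. by rewrite fmorph_eq0. Qed.
Let Q4 : Q ^+ 4 != 1. Proof. by rewrite -rmorphXn fmorph_eq1. Qed.

Lemma tau_at_neq0 n : tau_at n != 0.
Proof. by rewrite mulf_neq0 // expfz_neq0. Qed.

Lemma tau_atD1 n : tau_at (n + 1) = tau_at n / Q ^+ 2.
Proof.
by rewrite /tau_at mulrDr opprD expfzDr // mulrA.
Qed.

Lemma tau_atB1 n : tau_at (n - 1) = tau_at n * Q ^+ 2.
Proof.
rewrite /tau_at mulrBr opprB addrC expfzDr //.
by rewrite mulrA.
Qed.

Definition rep_alpha := - Q * f - e / (Q * b).
Definition rep_beta := - e / Q - Q * f / b.
Definition rep_gamma := g.

Ltac entrywise :=
  let v := fresh in let n := fresh in let x := fresh in let x0 := fresh in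
  apply: opP => v n;
  rewrite /AW_XA /op_fun /= !addrK ?subrK !tau_atD1 !tau_atB1;
  move: (tau_at_neq0 n); move: (tau_at n) => x x0;
  rewrite /phi_at /rep_alpha /rep_beta /rep_gamma
    fmorphV rmorphB fmorphV !rmorphXn fmorphV -/Q;
  move: (v (n + 1)) (v n) (v (n - 1)) (v (n - 1 - 1)) (v (n + 1 + 1)) => ? ? ? ? ?;
  field; rewrite /= -/Q ?b0 ?Q0 ?x0 ?(q2D1_neq0 Q4) ?(q4B1_neq0 Q4).

Lemma rep_XA : AW_XA q rep_A rep_B rep_C = op_scalar ((Q + Q^-1)^-1 * rep_alpha).
Proof. by entrywise. Qed.

Lemma rep_XB : AW_XA q rep_B rep_C rep_A = op_scalar ((Q + Q^-1)^-1 * rep_beta).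
Proof. by entrywise. Qed.

Lemma rep_XC : AW_XA q rep_C rep_A rep_B = op_scalar ((Q + Q^-1)^-1 * rep_gamma).
Proof. by entrywise. Qed.

Lemma AW_rel_rep : AW_rel q rep_A rep_B rep_C.
Proof.
move=> x y; rewrite rep_XA rep_XB rep_XC !inE => /or3P[] /eqP -> _;
exact: op_scalar_comm.
Qed.

Let QQV : Q + Q^-1 != 0.
Proof.
have -> : Q + Q^-1 = (Q * Q + 1) / Q by field.
by rewrite mulf_neq0 ?invr_eq0 // (q2D1_neq0 Q4).
Qed.

Let scale_op_scalar k : (q + q^-1) *: op_scalar ((Q + Q^-1)^-1 * k) = op_scalar k.
Proof.
apply: opP => v n; rewrite /op_fun /= rmorphD fmorphV -/Q.
by rewrite !mulrA mulfV // mul1r.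
Qed.

Lemma AW_alpha_rep : AW_alpha q rep_A rep_B rep_C = op_scalar rep_alpha.
Proof. by rewrite /AW_alpha rep_XA scale_op_scalar. Qed.

Lemma AW_beta_rep : AW_beta q rep_A rep_B rep_C = op_scalar rep_beta.
Proof. by rewrite /AW_beta rep_XB scale_op_scalar. Qed.

Lemma AW_gamma_rep : AW_gamma q rep_A rep_B rep_C = op_scalar rep_gamma.
Proof. by rewrite /AW_gamma rep_XC scale_op_scalar. Qed.

End Representation.

(** * Leading exponents and linear independence *)

Section Lead.

Variable F : fieldType.
Local Notation tofrac := (@FracField.tofrac {poly F}).
Local Notation K := {fraction {poly F}}.

Definition frac_const : {rmorphism F -> K} := tofrac \o polyC.

Local Notation Y := (tofrac 'X : K).

(* x = X^d (c + O(X^-1)) where X = Y^-1; here c = 0 is allowed. *)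
Definition lead (d : int) (c : F) (x : K) : Prop :=
  exists p : {poly F}, x = Y ^ (- d) * tofrac p /\ p`_0 = c.

Let Y0 : Y != 0. Proof. by rewrite tofrac_eq0 polyX_eq0. Qed.

Lemma lead_const k : lead 0 k (frac_const k).
Proof. by exists k%:P; rewrite oppr0 expr0z mul1r coefC eqxx. Qed.

Lemma lead_pow w : lead w 1 (Y ^ (- w)).
Proof. by exists 1; rewrite tofrac1 mulr1 coefC eqxx. Qed.

Lemma lead_zero d : lead d 0 0.
Proof. by exists 0; rewrite tofrac0 mulr0 coef0. Qed.

Lemma leadD d c c' x y : lead d c x -> lead d c' y -> lead d (c + c') (x + y).
Proof.
move=> [p [-> <-]] [p' [-> <-]]; exists (p + p').
by rewrite tofracD mulrDr coefD.
Qed.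

Lemma leadN d c x : lead d c x -> lead d (- c) (- x).
Proof. by move=> [p [-> <-]]; exists (- p); rewrite tofracN mulrN coefN. Qed.

Lemma leadM d d' c c' x y :
  lead d c x -> lead d' c' y -> lead (d + d') (c * c') (x * y).
Proof.
move=> [p [-> <-]] [p' [-> <-]]; exists (p * p').
by rewrite tofracM opprD expfzDr // mulrACA coef0M.
Qed.

Lemma lead_weak d d' c x : lead d c x -> d < d' -> lead d' 0 x.
Proof.
move=> [p [-> _]] ltd; exists ('X ^+ `|d' - d|%N * p).
rewrite coef0M coefXn; split; last first.
  have -> : (0%N == `|d' - d|%N) = false by lia.
  by rewrite mul0r.
rewrite tofracM tofracXn exprnP mulrA -expfzDr //; congr (_ ^ _ * _); lia.
Qed.

Lemma lead_eq0 d c : lead d c 0 -> c = 0.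
Proof.
move=> [p [/esym/eqP + <-]]; rewrite mulf_eq0 expfz_eq0 (negPf Y0) andbF /=.
by rewrite tofrac_eq0 => /eqP ->; rewrite coef0.
Qed.

Lemma lead_eq d d' c c' x : d = d' -> c = c' -> lead d c x -> lead d' c' x.
Proof. by move=> -> ->. Qed.

Lemma lead_sum (I : Type) (r : seq I) (P : pred I) d (u : I -> K) (c : I -> F) :
  (forall i, P i -> lead d (c i) (u i)) ->
  lead d (\sum_(i <- r | P i) c i) (\sum_(i <- r | P i) u i).
Proof.
move=> h; apply: (big_ind2 (fun c x => lead d c x)) => //.
- exact: lead_zero.
- by move=> *; exact: leadD.
Qed.

Variable s : int.

(* The shift by one counts as an operator of weight [s]. *)
Definition leads (v : int -> K) (d : int) (n0 : int) : Prop :=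
  exists2 c : int -> F, (forall n, (c n != 0) = (n == n0)) &
    forall n, lead (d + s * n) (c n) (v n).

Lemma leads_scalar w (k : F) x v d n0 :
  k != 0 -> lead w k x -> leads v d n0 ->
  leads (op_fun (op_scalar frac_const x) v) (d + w) n0.
Proof.
move=> k0 lx [c hc lv]; exists (fun n => k * c n) => n.
  by rewrite mulf_eq0 (negPf k0) /= hc.
by rewrite /op_fun /=; apply: (lead_eq _ _ (leadM lx (lv n))) => //; lia.
Qed.

Lemma leads_expr (u : op frac_const) v d w k n0 j :
  (forall v d n0, leads v d n0 -> leads (op_fun u v) (d + w) (n0 + k)) ->
  leads v d n0 -> leads (op_fun (u ^+ j) v) (d + w * j%:Z) (n0 + k * j%:Z).
Proof.
move=> hu hv; elim: j => [|j IH].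
  by rewrite expr0 !mulr0 !addr0; case: hv => c hc lv; exists c.
rewrite exprS; have := hu _ _ _ IH.
by congr (leads _ _ _); rewrite intS; ring.
Qed.

Definition rep_vacuum : int -> K := fun n => (n == 0)%:R.

Lemma leads_vacuum : leads rep_vacuum 0 0.
Proof.
exists (fun n => (n == 0)%:R) => n; first by case: (n == 0); rewrite ?oner_eq0 ?eqxx.
rewrite /rep_vacuum; case: eqP => [->|_]; last exact: lead_zero.
by rewrite mulr0; have := lead_pow 0; rewrite oppr0 expr0z.
Qed.

End Lead.

Definition frac_pow (F : fieldType) (w : int) : {fraction {poly F}} :=
  FracField.tofrac 'X ^ (- w).

(* [s], [wt], [wb], [we], [wf], [wg] are the weights of S, t, b, e, f, g: the
   inequalities make S, b t, b t^-1 S^-1, f, e, g the leading terms of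
   A, B, C, alpha, beta, gamma. *)
Definition admissible_weights (s wt wb we wf wg : int) : Prop :=
  [/\ [/\ wt < s, - wt < s & 0 < wt + s],
      [/\ wt < 0, we + wt < wb, wg < wb, 0 < wb & wf - wt < 2 * wb /\ - wt < wb],
      0 < wb + wt,
      [/\ s < wb, wf + s < 2 * wb & s < 2 * wb + wt] &
      we - wb < wf /\ wf - wb < we].

Section LeadRep.

Variables (F : fieldType) (q : F).
Local Notation tofrac := (@FracField.tofrac {poly F}).
Local Notation K := {fraction {poly F}}.
Local Notation iota := (frac_const F).
Local Coercion op_fun : op >-> Funclass.

Variables s wt wb we wf wg : int.

Hypotheses (q0 : q != 0) (hw : admissible_weights s wt wb we wf wg).

Local Notation X := (@frac_pow F).
Let b := X wb. Let tau := X wt. Let e := X we. Let f := X wf. Let g := X wg.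

Let lead_b : lead wb 1 b. Proof. exact: lead_pow. Qed.
Let lead_e : lead we 1 e. Proof. exact: lead_pow. Qed.
Let lead_f : lead wf 1 f. Proof. exact: lead_pow. Qed.
Let lead_g : lead wg 1 g. Proof. exact: lead_pow. Qed.

Lemma lead_powV w : lead (- w) 1 (X w)^-1.
Proof. by rewrite /frac_pow invr_expz; exact: lead_pow. Qed.

Lemma lead_iota_inv k : lead 0 k^-1 (iota k)^-1.
Proof. by rewrite -fmorphV; exact: lead_const. Qed.

Lemma lead_tau_at n : lead wt (q ^ (- (2 * n))) (tau_at iota q tau n).
Proof.
rewrite -[wt]addr0 -[q ^ _]mul1r; apply: leadM; first exact: lead_pow.
by rewrite -fmorphXz; exact: lead_const.
Qed.

Lemma lead_tau_atV n : lead (- wt) (q ^ (2 * n)) (tau_at iota q tau n)^-1.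
Proof.
rewrite invfM -[- wt]addr0 -[q ^ _]mul1r; apply: leadM; first exact: lead_powV.
by rewrite -fmorphXz -fmorphV invr_expz opprK; exact: lead_const.
Qed.

Lemma lead_phi n : lead wb (-1) (phi_at iota q b e f g (tau_at iota q tau n)).
Proof.
have [_ [? ? ? ? [? ?]] _ _ _] := hw.
have lt := lead_tau_at n; have ltV := lead_tau_atV n.
move: (tau_at _ _ _ _) lt ltV => x lt ltV.
rewrite /phi_at.
have lx2 : lead (wt + wt) (q ^ (- (2 * n)) * q ^ (- (2 * n))) (x ^+ 2) by exact: leadM.
have lx2V : lead (- wt - wt) (q ^ (2 * n) * q ^ (2 * n)) (x ^+ 2)^-1.
  by rewrite expr2 invfM; exact: leadM.
have lb := lead_b.
have lbV : lead (- wb) 1 b^-1 by exact: lead_powV.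
have lq2 := lead_const (q ^+ 2); rewrite rmorphXn in lq2.
have lq2V := lead_iota_inv (q ^+ 2); rewrite rmorphXn in lq2V.
have h1 : lead wb 0 (iota q ^+ 2 * b * x ^+ 2).
  by apply: (lead_weak (leadM (leadM lq2 lb) lx2)); lia.
have h2 : lead wb 0 (e * x).
  by apply: (lead_weak (leadM lead_e lt)); lia.
have h3 : lead wb (0 - 1 - 0) (g - b - b^-1).
  apply: leadD; first apply: leadD.
  - exact: (lead_weak lead_g).
  - exact: leadN.
  - by apply/leadN/(lead_weak lbV); lia.
have h4 : lead wb 0 (f / (b * x)).
  by rewrite invfM; apply: (lead_weak (leadM lead_f (leadM lbV ltV))); lia.
have h5 : lead wb 0 (1 / (iota q ^+ 2 * b * x ^+ 2)).
  by rewrite div1r 2!invfM; apply: (lead_weak (leadM (leadM lq2V lbV) lx2V)); lia.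
apply: (lead_eq _ _ (leadD (leadD (leadD (leadD h1 h2) h3) h4) h5)) => //; ring.
Qed.

Local Notation repA := (rep_A iota q tau).
Local Notation repB := (rep_B iota q b tau e f g).
Local Notation repC := (rep_C iota q b tau e f g).
Local Notation leads := (leads s).

Lemma leads_A v d n0 : leads v d n0 -> leads (repA v) (d + s) (n0 - 1).
Proof.
move=> [c hc lv]; exists (fun n => c (n + 1)) => [n|n].
  by rewrite hc; lia.
have [[? ? ?] _ _ _ _] := hw; rewrite /op_fun /= -[c _]addr0.
apply: leadD; first by apply: (lead_eq _ _ (lv (n + 1))) => //; lia.
rewrite [(_ + _) * v n]mulrDl -[0](addr0 0); apply: leadD.
- by apply: (lead_weak (leadM (lead_tau_at n) (lv n))); lia.
- by apply: (lead_weak (leadM (lead_tau_atV n) (lv n))); lia.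
Qed.

Lemma leads_B v d n0 : leads v d n0 -> leads (repB v) (d + (wb + wt)) n0.
Proof.
move=> [c hc lv]; exists (fun n => q ^ (- (2 * n)) * c n) => [n|n].
  by rewrite mulf_eq0 expfz_eq0 (negPf q0) andbF /= hc.
have [[? ? ?] _ ? _ _] := hw; rewrite /op_fun /= -[_ * c _]addr0.
have lb := lead_b.
have lbV : lead (- wb) 1 b^-1 by exact: lead_powV.
apply: leadD; last first.
  by apply: (lead_weak (leadM (lead_phi n) (lv (n - 1)))); lia.
rewrite [(_ + _) * v n]mulrDl -[_ * c _]addr0; apply: leadD.
- by apply: (lead_eq _ _ (leadM (leadM lb (lead_tau_at n)) (lv n))); [lia | rewrite mul1r].
- rewrite invfM.
  by apply: (lead_weak (leadM (leadM lbV (lead_tau_atV n)) (lv n))); lia.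
Qed.

Lemma leads_C v d n0 : leads v d n0 -> leads (repC v) (d + (wb - wt - s)) (n0 + 1).
Proof.
move=> [c hc lv]; exists (fun n => q^-1 * q ^ (2 * n) * c (n - 1)) => [n|n].
  by rewrite !mulf_eq0 expfz_eq0 invr_eq0 (negPf q0) andbF /= hc; lia.
have [_ [? ? ? ? [? ?]] ? [? ? ?] _] := hw; rewrite /op_fun /=.
have lb := lead_b.
have lbV : lead (- wb) 1 b^-1 by exact: lead_powV.
have lx := lead_tau_atV n.
have lq := lead_const q; have lqV := lead_iota_inv q.
have h1 : lead (d + (wb - wt - s) + s * n) 0
    (- (iota q / (b * tau_at iota q tau n)) * v (n + 1)).
  rewrite mulNr -oppr0; apply: leadN; rewrite invfM.
  by apply: (lead_weak (leadM (leadM lq (leadM lbV lx)) (lv (n + 1)))); lia.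
have h2 : lead (d + (wb - wt - s) + s * n) 0
    (iota q * f / (b * tau_at iota q tau n) * v n).
  rewrite invfM.
  by apply: (lead_weak (leadM (leadM (leadM lq lead_f) (leadM lbV lx)) (lv n))); lia.
have h3 : lead (d + (wb - wt - s) + s * n) 0
    ((iota q + (iota q)^-1) / (b * tau_at iota q tau n ^+ 2) * v n).
  have lx2 : lead (- wt - wt) (q ^ (2 * n) * q ^ (2 * n)) (tau_at iota q tau n ^+ 2)^-1.
    by rewrite expr2 invfM; exact: leadM.
  rewrite invfM.
  by apply: (lead_weak (leadM (leadM (leadD lq lqV) (leadM lbV lx2)) (lv n))); lia.
have h4 : lead (d + (wb - wt - s) + s * n) (- (q^-1 * q ^ (2 * n) * c (n - 1)))
    (phi_at iota q b e f g (tau_at iota q tau n) / (iota q * tau_at iota q tau n)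
     * v (n - 1)).
  rewrite invfM.
  by apply: (lead_eq _ _ (leadM (leadM (lead_phi n) (leadM lqV lx)) (lv (n - 1))));
    [lia | ring].
have := leadD (leadD h1 (leadN (leadD h2 h3))) (leadN h4).
by rewrite -mulrDl -!mulNr; apply: lead_eq; last ring.
Qed.

Lemma lead_alpha : lead wf (- q) (rep_alpha iota q b e f).
Proof.
have [_ _ ? _ [? ?]] := hw; rewrite /rep_alpha -[- q]subr0; apply: leadD.
  rewrite mulNr; apply: leadN.
  by apply: (lead_eq _ _ (leadM (lead_const q) lead_f)); [lia | rewrite mulr1].
rewrite invfM; apply: leadN.
by apply: (lead_weak (leadM lead_e (leadM (lead_iota_inv q) (lead_powV wb)))); lia.
Qed.

Lemma lead_beta : lead we (- q^-1) (rep_beta iota q b e f).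
Proof.
have [_ _ ? _ [? ?]] := hw; rewrite /rep_beta -[- q^-1]subr0; apply: leadD.
  rewrite mulNr; apply: leadN.
  by apply: (lead_eq _ _ (leadM lead_e (lead_iota_inv q))); [lia | rewrite mul1r].
apply: leadN.
by apply: (lead_weak (leadM (leadM (lead_const q) lead_f) (lead_powV wb))); lia.
Qed.

End LeadRep.

Definition pbw_index : Type := nat * nat * nat * (nat * nat * nat).

Definition pbw (F : fieldType) (D : algType F) (q : F) (A B C : D) (m : pbw_index) : D :=
  let: (i, j, k, (r, s, t)) := m in
  A ^+ i * B ^+ j * C ^+ k
  * (AW_alpha q A B C ^+ r * AW_beta q A B C ^+ s * AW_gamma q A B C ^+ t).

Section AlgHom.

Variables (F : fieldType) (q : F) (D R : algType F) (f : D -> R).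
Hypothesis hf : is_alg_hom f.

Lemma alg_homD x y : f (x + y) = f x + f y. Proof. by case: hf. Qed.
Lemma alg_homM x y : f (x * y) = f x * f y. Proof. by case: hf. Qed.
Lemma alg_homZ k x : f (k *: x) = k *: f x. Proof. by case: hf. Qed.
Lemma alg_hom1 : f 1 = 1. Proof. by case: hf. Qed.

Lemma alg_hom0 : f 0 = 0.
Proof. by rewrite -[X in f X](scale0r 0) alg_homZ scale0r. Qed.

Lemma alg_homB x y : f (x - y) = f x - f y.
Proof. by rewrite -scaleN1r alg_homD alg_homZ scaleN1r. Qed.

Lemma alg_homX x n : f (x ^+ n) = f x ^+ n.
Proof. by elim: n => [|n IH]; rewrite ?expr0 ?alg_hom1 // !exprS alg_homM IH. Qed.

Lemma alg_hom_sum (I : Type) (r : seq I) (P : pred I) (u : I -> D) :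
  f (\sum_(i <- r | P i) u i) = \sum_(i <- r | P i) f (u i).
Proof. exact: (big_morph f alg_homD alg_hom0). Qed.

Lemma alg_hom_XA a b c : f (AW_XA q a b c) = AW_XA q (f a) (f b) (f c).
Proof. by rewrite /AW_XA alg_homD alg_homZ alg_homB !alg_homZ !alg_homM. Qed.

Lemma alg_hom_pbw a b c m : f (pbw q a b c m) = pbw q (f a) (f b) (f c) m.
Proof.
case: m => [[[i j] k] [[r s] t]].
by rewrite /pbw !(alg_homM, alg_homX) /AW_alpha /AW_beta /AW_gamma !alg_homZ !alg_hom_XA.
Qed.

End AlgHom.

Lemma seq_argmax (T : eqType) (w : T -> nat) (l : seq T) (x : T) :
  x \in l -> exists2 m, m \in l & forall y, y \in l -> (w y <= w m)%N.
Proof.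
elim: l x => // a [_ x _|b l IH x _].
  by exists a; rewrite ?inE // => y; rewrite inE => /eqP ->.
have [m ml hm] := IH b (mem_head _ _).
have [le|lt] := leqP (w m) (w a).
- exists a; first by rewrite inE eqxx.
  by move=> y; rewrite inE => /predU1P[->//|/hm h]; exact: leq_trans h le.
- exists m; first by rewrite inE ml orbT.
  by move=> y; rewrite inE => /predU1P[->|/hm//]; exact: ltnW.
Qed.

Lemma base_digit N a a' x x' : (a < N)%N -> (a' < N)%N ->
  (a + N * x = a' + N * x')%N -> a = a' /\ x = x'.
Proof.
move=> ltaN lta'N e.
have N0 : (0 < N)%N by apply: leq_ltn_trans ltaN.
have := congr1 (divn^~ N) e; have := congr1 (modn^~ N) e.
rewrite ![(N * _)%N]mulnC ![(_ + _ * N)%N]addnC !modnMDl !divnMDl //.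
by rewrite !modn_small // !divn_small // !addn0.
Qed.

(* The digits of a PBW index in base [N], with the total degree in A, B, C most
   significant. *)
Definition pbw_weight (N : nat) (m : pbw_index) : nat :=
  let: (i, j, k, (r, s, t)) := m in
  (i + N * (j + N * (k + N * (r + N * (s + N * (t + N * (10 * (i + j + k))))))))%N.

Definition pbw_bounded (N : nat) (m : pbw_index) : bool :=
  let: (i, j, k, (r, s, t)) := m in
  [&& (i < N)%N, (j < N)%N, (k < N)%N, (r < N)%N, (s < N)%N & (t < N)%N].

Lemma pbw_weight_inj N m m' : pbw_bounded N m -> pbw_bounded N m' ->
  pbw_weight N m = pbw_weight N m' -> m = m'.
Proof.
case: m m' => [[[i j] k] [[r s] t]] [[[i' j'] k'] [[r' s'] t']].
case/and5P=> ? ? ? ? /andP[? ?] /and5P[? ? ? ? /andP[? ?]] /=.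
do 6!(case/base_digit => // <-).
by [].
Qed.

Lemma pbw_boundedP (l : seq pbw_index) :
  exists2 N, (0 < N)%N & forall m, m \in l -> pbw_bounded N m.
Proof.
elim: l => [|[[[i j] k] [[r s] t]] l [N N0 IH]]; first by exists 1.
exists (N + (i + j + k + r + s + t).+1)%N; first by lia.
move=> m; rewrite inE => /predU1P[->|/IH]; first by rewrite /pbw_bounded; lia.
case: m => [[[i' j'] k'] [[r' s'] t']]; rewrite /pbw_bounded; lia.
Qed.

Section PbwFree.

Variables (F : fieldType) (q : F) (D : algType F) (A B C : D).
Hypotheses (q0 : q != 0) (q4 : q ^+ 4 != 1) (hD : is_universal_AW q A B C).

Lemma op_funM (K : fieldType) (iota : {rmorphism F -> K}) (x y : op iota) v :
  op_fun (x * y) v = op_fun x (op_fun y v).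
Proof. by []. Qed.

Lemma pbw_leads_rep (N : nat) : (0 < N)%N ->
  exists s (f : D -> op (frac_const F)), is_alg_hom f /\
    forall m, exists n0, leads s (op_fun (f (pbw q A B C m)) (@rep_vacuum F))
                          (2 * (pbw_weight N m)%:Z) n0.
Proof.
move=> N0.
set p1 := N%:Z; pose p2 := p1 * p1; pose p3 := p2 * p1; pose p4 := p3 * p1.
pose p5 := p4 * p1; pose p6 := p5 * p1; pose M := 10 * p6.
pose s := 2 * (M + 1); pose wb := 3 * M + 1 + p1 + p2.
pose wt := 2 * (M + p1) - wb.
pose wf := 2 * p3; pose we := 2 * p4; pose wg := 2 * p5.
have X0 w : frac_pow F w != 0 by rewrite expfz_neq0 // tofrac_eq0 polyX_eq0.
have [g1 g2 g3 g4 [g5 g6]] :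
  [/\ 1 <= p1, p1 <= p2, p2 <= p3, p3 <= p4 & p4 <= p5 /\ p5 <= p6].
  have h : 1 <= p1 by lia.
  by rewrite /p6 /p5 /p4 /p3 /p2; do !split => //; nia.
have hw : admissible_weights s wt wb we wf wg.
  by rewrite /wt /wf /we /wg /s /wb /M; do !split; lia.
have [_ hu] := hD.
have [[f [hf [fA [fB fC]]]] _] := hu _ _ _ _
  (@AW_rel_rep F _ (frac_const F) q (frac_pow F wb) (frac_pow F wt)
    (frac_pow F we) (frac_pow F wf) (frac_pow F wg) q0 q4 (X0 _) (X0 _)).
exists s, f; split=> // -[[[i j] k] [[r u] t]].
exists (0 + 0 * t%:Z + 0 * u%:Z + 0 * r%:Z + 1 * k%:Z + 0 * j%:Z + (-1) * i%:Z).
have -> : 2 * (pbw_weight N (i, j, k, (r, u, t)))%:Z =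
   0 + wg * t%:Z + we * u%:Z + wf * r%:Z + (wb - wt - s) * k%:Z + (wb + wt) * j%:Z + s * i%:Z.
  rewrite /pbw_weight !(PoszD, PoszM) -/p1 /wg /we /wf /wt /wb /s /M /p6 /p5 /p4 /p3 /p2.
  ring.
rewrite (alg_hom_pbw q hf) fA fB fC /pbw.
rewrite AW_alpha_rep ?AW_beta_rep ?AW_gamma_rep //; try exact: X0.
rewrite !op_funM.
apply: leads_expr => [v d n0 hv|]; first exact (leads_A q0 hw hv).
apply: leads_expr => [v d n0 hv|]; first by rewrite addr0; exact (leads_B q0 hw hv).
apply: leads_expr => [v d n0 hv|]; first exact (leads_C q0 hw hv).
have qN0 : - q != 0 by rewrite oppr_eq0.
have qVN0 : - q^-1 != 0 by rewrite oppr_eq0 invr_eq0.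
apply: leads_expr => [v d n0 hv|].
  by rewrite addr0; apply: leads_scalar hv; [exact: qN0 | exact (lead_alpha q0 hw)].
apply: leads_expr => [v d n0 hv|].
  by rewrite addr0; apply: leads_scalar hv; [exact: qVN0 | exact (lead_beta q0 hw)].
apply: leads_expr => [v d n0 hv|].
  by rewrite addr0; apply: leads_scalar hv; [exact: oner_neq0 | exact: lead_pow].
exact: leads_vacuum.
Qed.

Lemma pbw_free (l : seq pbw_index) (c : pbw_index -> F) :
  uniq l -> \sum_(m <- l) c m *: pbw q A B C m = 0 -> forall m, m \in l -> c m = 0.
Proof.
move=> ul e0 m ml; apply/eqP/negPn/negP => cm.
have [N N0 hN] := pbw_boundedP l.
have [s [f [hf hl]]] := pbw_leads_rep N0.
have : m \in [seq x <- l | c x != 0] by rewrite mem_filter cm.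
case/(seq_argmax (pbw_weight N)) => {cm ml}m; rewrite mem_filter => /andP[cm ml] hmax.
have [n0 [d hd lm]] := hl m.
pose v x := op_fun (f (pbw q A B C x)) (@rep_vacuum F) n0.
have sum0 : \sum_(x <- l) frac_const F (c x) * v x = 0.
  have := congr1 (fun x => op_fun (f x) (@rep_vacuum F) n0) e0.
  rewrite (alg_hom_sum hf) (alg_hom0 hf) => h.
  rewrite -[RHS]/(op_fun (0 : op (frac_const F)) (@rep_vacuum F) n0) -h.
  rewrite (big_morph (fun x => op_fun x (@rep_vacuum F) n0) (id1 := 0) (op1 := +%R)) //.
  by apply: eq_bigr => x _; rewrite (alg_homZ hf).
have : lead (2 * (pbw_weight N m)%:Z + s * n0) (\sum_(x <- l) if x == m then c m * d n0 else 0) 0.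
  rewrite -sum0 !big_seq; apply: lead_sum => x xl.
  case: eqP => [->|/eqP xm].
    by rewrite -[X in lead X]add0r; apply: leadM (lm n0); exact: lead_const.
  have [cx0|cx] := eqVneq (c x) 0.
    by rewrite cx0 rmorph0 mul0r; exact: lead_zero.
  have [n1 [d' _ lx]] := hl x.
  apply: (lead_weak (leadM (lead_const (c x)) (lx n0))).
  suff : (pbw_weight N x < pbw_weight N m)%N by lia.
  rewrite ltn_neqAle hmax ?mem_filter ?cx // andbT.
  by apply: contra xm => /eqP/pbw_weight_inj ->; rewrite ?hN.
move/lead_eq0; rewrite (bigD1_seq m) //= eqxx big1 ?addr0 => [|x /negPf -> //].
by move/eqP; rewrite mulf_eq0 (negPf cm) /= -[_ == 0]negbK hd eqxx.
Qed.

End PbwFree.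

(** * Identities in noncommutative polynomials *)

Section NcReflection.

Variables (F : fieldType) (D : algType F).

Inductive nc_exp :=
  | NcAtom of nat
  | NcAdd of nc_exp & nc_exp
  | NcOpp of nc_exp
  | NcMul of nc_exp & nc_exp
  | NcScale of F & nc_exp.

Fixpoint nc_eval (env : seq D) (e : nc_exp) : D :=
  match e with
  | NcAtom n => nth 0 env n
  | NcAdd x y => nc_eval env x + nc_eval env y
  | NcOpp x => - nc_eval env x
  | NcMul x y => nc_eval env x * nc_eval env y
  | NcScale k x => k *: nc_eval env x
  end.

Fixpoint nc_word_eq (v w : seq nat) : bool :=
  match v, w with
  | [::], [::] => true
  | m :: v, n :: w => if Nat.eqb m n then nc_word_eq v w else false
  | _, _ => false
  end.

Fixpoint nc_insert (k : F) (w : seq nat) (l : seq (F * seq nat)) :=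
  match l with
  | [::] => [:: (k, w)]
  | (k', w') :: l =>
      if nc_word_eq w w' then (k' + k, w') :: l else (k', w') :: nc_insert k w l
  end.

Fixpoint nc_add (l l' : seq (F * seq nat)) :=
  match l with
  | [::] => l'
  | (k, w) :: l => nc_insert k w (nc_add l l')
  end.

Fixpoint nc_scale (k : F) (l : seq (F * seq nat)) :=
  match l with
  | [::] => [::]
  | (k', w) :: l => (k * k', w) :: nc_scale k l
  end.

Fixpoint nc_app (v w : seq nat) :=
  match v with [::] => w | n :: v => n :: nc_app v w end.

Fixpoint nc_lmul (k : F) (w : seq nat) (l : seq (F * seq nat)) :=
  match l with
  | [::] => [::]
  | (k', w') :: l => (k * k', nc_app w w') :: nc_lmul k w l
  end.

Fixpoint nc_mul (l l' : seq (F * seq nat)) :=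
  match l with
  | [::] => [::]
  | (k, w) :: l => nc_add (nc_lmul k w l') (nc_mul l l')
  end.

Fixpoint nc_norm (e : nc_exp) : seq (F * seq nat) :=
  match e with
  | NcAtom n => [:: (1, [:: n])]
  | NcAdd x y => nc_add (nc_norm x) (nc_norm y)
  | NcOpp x => nc_scale (-1) (nc_norm x)
  | NcMul x y => nc_mul (nc_norm x) (nc_norm y)
  | NcScale k x => nc_scale k (nc_norm x)
  end.

Fixpoint nc_null (l : seq (F * seq nat)) : Prop :=
  match l with
  | [::] => True
  | (k, _) :: l => k = 0 /\ nc_null l
  end.

Variable env : seq D.

Let word (w : seq nat) : D := foldr (fun n x => nth 0 env n * x) 1 w.
Let value (l : seq (F * seq nat)) : D := foldr (fun p x => p.1 *: word p.2 + x) 0 l.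

Lemma nc_word_eqP v w : nc_word_eq v w -> v = w.
Proof.
elim: v w => [|m v IH] [|n w] //=.
case e : (Nat.eqb m n) => // /IH ->.
by move/PeanoNat.Nat.eqb_eq: e => ->.
Qed.

Let value_insert k w l : value (nc_insert k w l) = k *: word w + value l.
Proof.
elim: l => [|[k' w'] l IH] //=.
case: ifP => [/nc_word_eqP <-|_] /=; last by rewrite IH addrCA.
by rewrite scalerDl addrA [_ *: _ + _]addrC.
Qed.

Let value_add l l' : value (nc_add l l') = value l + value l'.
Proof.
elim: l => [|[k w] l IH] /=; first by rewrite add0r.
by rewrite value_insert IH addrA.
Qed.

Let value_scale k l : value (nc_scale k l) = k *: value l.
Proof.
elim: l => [|[k' w] l IH] /=; first by rewrite scaler0.
by rewrite IH scalerDr scalerA.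
Qed.

Let word_app v w : word (nc_app v w) = word v * word w.
Proof. by elim: v => [|n v IH] /=; rewrite ?mul1r // IH mulrA. Qed.

Let value_lmul k w l : value (nc_lmul k w l) = k *: word w * value l.
Proof.
elim: l => [|[k' w'] l IH] /=; first by rewrite mulr0.
by rewrite IH mulrDr word_app -scalerAr -!scalerAl !scalerA [k' * k]mulrC.
Qed.

Let value_mul l l' : value (nc_mul l l') = value l * value l'.
Proof.
elim: l => [|[k w] l IH] /=; first by rewrite mul0r.
by rewrite value_add value_lmul IH mulrDl.
Qed.

Let value_norm e : value (nc_norm e) = nc_eval env e.
Proof.
elim: e => [n|x IHx y IHy|x IHx|x IHx y IHy|k x IHx] /=.
- by rewrite scale1r addr0 mulr1.
- by rewrite value_add IHx IHy.
- by rewrite value_scale IHx scaleN1r.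
- by rewrite value_mul IHx IHy.
- by rewrite value_scale IHx.
Qed.

Let value_null l : nc_null l -> value l = 0.
Proof. by elim: l => [|[k w] l IH] //= [-> /IH ->]; rewrite scale0r addr0. Qed.

Lemma nc_eq0 e : nc_null (nc_norm e) -> nc_eval env e = 0.
Proof. by rewrite -value_norm; apply: value_null. Qed.

End NcReflection.

Ltac nc_index x env :=
  lazymatch env with
  | x :: _ => constr:(O)
  | _ :: ?env' => let n := nc_index x env' in constr:(S n)
  end.

Ltac nc_quote F env t :=
  lazymatch t with
  | ?a + ?b => let x := nc_quote F env a in let y := nc_quote F env b in constr:(NcAdd x y)
  | - ?a => let x := nc_quote F env a in constr:(NcOpp x)
  | ?a * ?b => let x := nc_quote F env a in let y := nc_quote F env b in constr:(NcMul x y)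
  | ?k *: ?a => let x := nc_quote F env a in constr:(NcScale k x)
  | _ => let n := nc_index t env in constr:(NcAtom F n)
  end.

(* The goal becomes one scalar equation per word in the atoms [env]. *)
Ltac nc_reduce F env :=
  apply/subr0_eq;
  lazymatch goal with
  | |- ?t = _ =>
      let e := nc_quote F env t in
      apply: (@nc_eq0 _ _ env e);
      cbv [nc_norm nc_mul nc_add nc_insert nc_scale nc_lmul nc_app nc_word_eq Nat.eqb nc_null]
  end.

(** * The Casimir element *)

Section Relations.

Variables (F : fieldType) (q : F).
Hypotheses (q0 : q != 0) (q4 : q ^+ 4 != 1).

Ltac qfield := do ?split; field; rewrite /= ?q0 ?(q2D1_neq0 q4) ?(q4B1_neq0 q4).

Lemma AW_swap (D : algType F) (a b c : D) :
  c * b = q ^+ 2 *: (b * c) + (q * (q ^+ 2 - q ^- 2)) *: a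
          - (q * (q - q^-1)) *: ((q + q^-1) *: AW_XA q a b c).
Proof.
rewrite /AW_XA.
nc_reduce F [:: a; b; c].
by qfield.
Qed.

Section Casimir.

Variables (D : algType F) (a b c al be ga : D).
Let u := q * (q ^+ 2 - q ^- 2).
Let v := q * (q - q^-1).

Hypothesis ba : b * a = q ^+ 2 *: (a * b) + u *: c - v *: ga.
Hypothesis ac : a * c = q ^+ 2 *: (c * a) + u *: b - v *: be.
Hypotheses (al_a : al * a = a * al) (be_a : be * a = a * be) (be_c : be * c = c * be).
Hypotheses (ga_a : ga * a = a * ga) (ga_b : ga * b = b * ga) (ga_c : ga * c = c * ga).
Hypothesis ga_be : ga * be = be * ga.

Definition casimir (a b c al be ga : D) : D :=
  q *: (a * b * c) + q ^+ 2 *: (a * a) + q ^- 2 *: (b * b) + q ^+ 2 *: (c * c)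
  - q *: (a * al) - q^-1 *: (b * be) - q *: (c * ga).

Let r1 := b * a - (q ^+ 2 *: (a * b) + u *: c - v *: ga).
Let r3 := a * c - (q ^+ 2 *: (c * a) + u *: b - v *: be).

Let r1_0 : r1 = 0. Proof. by apply/eqP; rewrite subr_eq0 ba. Qed.
Let r3_0 : r3 = 0. Proof. by apply/eqP; rewrite subr_eq0 ac. Qed.

Lemma casimir_rot : casimir a b c al be ga = casimir b c a be ga al.
Proof.
have : casimir a b c al be ga - casimir b c a be ga al =
   - (q^-1 *: (r1 * c - b * r3 - v *: (ga * c - c * ga))).
  rewrite /casimir /r1 /r3 /v /u.
  nc_reduce F [:: a; b; c; al; be; ga].
  by qfield.
rewrite r1_0 r3_0 ga_c subrr scaler0 mul0r mulr0 !subr0 scaler0 oppr0.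
exact: subr0_eq.
Qed.

Lemma casimir_comm : a * casimir a b c al be ga = casimir a b c al be ga * a.
Proof.
pose k x y : D := x * y - y * x.
have : a * casimir a b c al be ga - casimir a b c al be ga * a =
    q^-1 *: (a * b * r3) - q ^- 2 *: (b * r1) + c * r3 - q^-1 *: (a * r1 * c)
    - r1 * b + q ^- 2 *: (r3 * c) + q^-1 *: (r1 * be) - q^-1 *: (r3 * ga)
    + q *: (a * k al a) + q^-1 *: (b * k be a) + q *: (c * k ga a)
    + (q - q^-1) *: (a * k ga c) + (q ^+ 2 - 1) *: k ga b
    + (q ^- 2 - 1) *: k be c + (q - q^-1) *: k be ga.
  rewrite /casimir /r1 /r3 /v /u /k.
  nc_reduce F [:: a; b; c; al; be; ga].
  by qfield.
rewrite r1_0 r3_0 /k al_a be_a be_c ga_a ga_b ga_c ga_be !subrr.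
rewrite !(mulr0, mul0r, scaler0, addr0, subr0, oppr0).
exact: subr0_eq.
Qed.

End Casimir.

End Relations.

(** * The degree filtration *)

Definition pbw_deg (m : pbw_index) : nat :=
  let: (i, j, k, _) := m in (i + j + k)%N.

Section Filtration.

Variables (F : fieldType) (q : F) (D : algType F) (A B C : D).
Hypotheses (q0 : q != 0) (q4 : q ^+ 4 != 1) (hr : AW_rel q A B C).

Local Notation al := (AW_alpha q A B C).
Local Notation be := (AW_beta q A B C).
Local Notation ga := (AW_gamma q A B C).
Local Notation mon := (pbw q A B C).
Let u := q * (q ^+ 2 - q ^- 2).
Let v := q * (q - q^-1).

Lemma AW_BA : B * A = q ^+ 2 *: (A * B) + u *: C - v *: ga.
Proof. exact: AW_swap. Qed.
Lemma AW_CB : C * B = q ^+ 2 *: (B * C) + u *: A - v *: al.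
Proof. exact: AW_swap. Qed.
Lemma AW_AC : A * C = q ^+ 2 *: (C * A) + u *: B - v *: be.
Proof. exact: AW_swap. Qed.

Lemma AW_CA : C * A = q ^- 2 *: (A * C) - q ^- 2 *: (u *: B - v *: be).
Proof.
have -> : A * C = q ^+ 2 *: (C * A) + (u *: B - v *: be) by rewrite AW_AC addrA.
by rewrite -scalerBr addrK scalerA mulVf ?scale1r ?expf_neq0.
Qed.

Definition gen_central (z : D) := forall y, y \in [:: A; B; C] -> z * y = y * z.

Lemma gen_centralZ k z : gen_central z -> gen_central (k *: z).
Proof. by move=> hz y /hz h; rewrite -scalerAl h scalerAr. Qed.

Lemma gen_central_al : gen_central al.
Proof. by apply: gen_centralZ => y; apply: hr; rewrite !inE eqxx. Qed.
Lemma gen_central_be : gen_central be.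
Proof. by apply: gen_centralZ => y; apply: hr; rewrite !inE eqxx ?orbT. Qed.
Lemma gen_central_ga : gen_central ga.
Proof. by apply: gen_centralZ => y; apply: hr; rewrite !inE eqxx ?orbT. Qed.

Lemma gen_centralP z : gen_central z -> [/\ z * A = A * z, z * B = B * z & z * C = C * z].
Proof. by move=> h; split; apply: h; rewrite !inE eqxx ?orbT. Qed.

Lemma commrZ (x y : D) k : GRing.comm x y -> GRing.comm x (k *: y).
Proof. by move=> h; rewrite /GRing.comm -scalerAr h scalerAl. Qed.

Lemma gen_central_XA z a b c : gen_central z ->
  a \in [:: A; B; C] -> b \in [:: A; B; C] -> c \in [:: A; B; C] ->
  GRing.comm z (AW_XA q a b c).
Proof.
move=> hz ha hb hc; apply: commrD; first exact: hz.
apply/commrZ/commrB; apply/commrZ/commrM; exact: hz.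
Qed.

Lemma gen_central_params z : gen_central z ->
  [/\ GRing.comm z al, GRing.comm z be & GRing.comm z ga].
Proof.
move=> hz; split; apply/commrZ/gen_central_XA => //; rewrite !inE eqxx ?orbT //.
Qed.

Lemma gen_central_pbw z m : gen_central z -> GRing.comm z (mon m).
Proof.
move=> hz; have [zA zB zC] := gen_centralP hz.
have [zal zbe zga] := gen_central_params hz.
by case: m => [[[i j] k] [[r s] t]]; do !apply: commrM; apply: commrX.
Qed.

Definition pbw_lt (n : nat) (x : D) : Prop :=
  exists2 l : seq (F * pbw_index), (forall p, p \in l -> (pbw_deg p.2 < n)%N) &
    x = \sum_(p <- l) p.1 *: mon p.2.

Lemma pbw_lt0 n : pbw_lt n 0.
Proof. by exists [::] => //; rewrite big_nil. Qed.

Lemma pbw_ltD n x y : pbw_lt n x -> pbw_lt n y -> pbw_lt n (x + y).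
Proof.
move=> [l hl ->] [l' hl' ->]; exists (l ++ l'); last by rewrite big_cat.
by move=> p; rewrite mem_cat => /orP[/hl|/hl'].
Qed.

Lemma pbw_ltZ n k x : pbw_lt n x -> pbw_lt n (k *: x).
Proof.
move=> [l hl ->]; exists [seq (k * p.1, p.2) | p <- l].
  by move=> _ /mapP[p /hl ? ->].
by rewrite big_map scaler_sumr; apply: eq_bigr => p _; rewrite scalerA.
Qed.

Lemma pbw_ltN n x : pbw_lt n x -> pbw_lt n (- x).
Proof. by rewrite -scaleN1r; apply: pbw_ltZ. Qed.

Lemma pbw_ltB n x y : pbw_lt n x -> pbw_lt n y -> pbw_lt n (x - y).
Proof. by move=> hx /pbw_ltN; apply: pbw_ltD. Qed.

Lemma pbw_lt_mon n m : (pbw_deg m < n)%N -> pbw_lt n (mon m).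
Proof.
move=> h; exists [:: (1, m)]; first by move=> p; rewrite inE => /eqP ->.
by rewrite big_seq1 scale1r.
Qed.

Lemma pbw_ltW n n' x : (n <= n')%N -> pbw_lt n x -> pbw_lt n' x.
Proof.
move=> le [l hl ->]; exists l => // p /hl h; exact: leq_trans h le.
Qed.

Lemma pbw_lt_ind n (P : D -> Prop) :
  P 0 -> (forall x y, P x -> P y -> P (x + y)) -> (forall k x, P x -> P (k *: x)) ->
  (forall m, (pbw_deg m < n)%N -> P (mon m)) -> forall x, pbw_lt n x -> P x.
Proof.
move=> P0 PD PZ Pm x [l hl ->]; rewrite big_seq.
by apply: big_ind => // p /hl h; apply/PZ/Pm.
Qed.

Lemma pbw_lt_lmul n n' z :
  (forall m, (pbw_deg m < n)%N -> pbw_lt n' (z * mon m)) ->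
  forall x, pbw_lt n x -> pbw_lt n' (z * x).
Proof.
move=> h; apply: pbw_lt_ind => [|x y hx hy|k x hx|//].
- by rewrite mulr0; exact: pbw_lt0.
- by rewrite mulrDr; exact: pbw_ltD.
- by rewrite -scalerAr; exact: pbw_ltZ.
Qed.

Lemma pbw_lt_eq0 x : pbw_lt 0 x -> x = 0.
Proof.
case=> l hl ->; rewrite big_seq big1 // => p /hl; by rewrite ltn0.
Qed.

Lemma pbw_lt_A n x : pbw_lt n x -> pbw_lt n.+1 (A * x).
Proof.
apply: pbw_lt_lmul => -[[[i j] k] z] h.
have -> : A * mon (i, j, k, z) = mon (i.+1, j, k, z).
  by case: z h => [[r s] t] h; rewrite /pbw exprS !mulrA.
by apply: pbw_lt_mon; move: h; rewrite /=; lia.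
Qed.

Lemma pbw_lt_al n x : pbw_lt n x -> pbw_lt n (al * x).
Proof.
apply: pbw_lt_lmul => m h; rewrite gen_central_pbw; last exact: gen_central_al.
case: m h => [[[i j] k] [[r s] t]] h.
have [_ cb cg] := gen_central_params gen_central_al.
have -> : mon (i, j, k, (r, s, t)) * al = mon (i, j, k, (r.+1, s, t)).
  rewrite /pbw exprSr -!mulrA -(commrX t cg) [be ^+ s * (al * _)]mulrA.
  by rewrite -(commrX s cb) -!mulrA.
by apply: pbw_lt_mon.
Qed.

Lemma pbw_lt_be n x : pbw_lt n x -> pbw_lt n (be * x).
Proof.
apply: pbw_lt_lmul => m h; rewrite gen_central_pbw; last exact: gen_central_be.
case: m h => [[[i j] k] [[r s] t]] h.
have [_ _ cg] := gen_central_params gen_central_be.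
have -> : mon (i, j, k, (r, s, t)) * be = mon (i, j, k, (r, s.+1, t)).
  by rewrite /pbw exprSr -!mulrA -(commrX t cg).
by apply: pbw_lt_mon.
Qed.

Lemma pbw_lt_ga n x : pbw_lt n x -> pbw_lt n (ga * x).
Proof.
apply: pbw_lt_lmul => m h; rewrite gen_central_pbw; last exact: gen_central_ga.
case: m h => [[[i j] k] [[r s] t]] h.
have -> : mon (i, j, k, (r, s, t)) * ga = mon (i, j, k, (r, s, t.+1)).
  by rewrite /pbw -!mulrA exprSr.
by apply: pbw_lt_mon.
Qed.

(* Moving C past B needs B on elements of the same degree, whence the order in
   the induction: first B, then C. *)
Lemma pbw_lt_BC n :
  (forall x, pbw_lt n x -> pbw_lt n.+1 (B * x)) /\
  (forall x, pbw_lt n x -> pbw_lt n.+1 (C * x)).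
Proof.
elim: n => [|n [IHB IHC]].
  by split=> x /pbw_lt_eq0 ->; rewrite mulr0; exact: pbw_lt0.
have pred i j k z : (pbw_deg (i.+1, j, k, z) < n.+1)%N ->
    [/\ pbw_lt n (mon (i, j, k, z)) & mon (i.+1, j, k, z) = A * mon (i, j, k, z)].
  move=> h; split; first by apply: pbw_lt_mon; move: h => /=; lia.
  by case: z h => [[r s] t] h; rewrite /pbw exprS !mulrA.
have hB x : pbw_lt n.+1 x -> pbw_lt n.+2 (B * x).
  apply: pbw_lt_lmul => -[[[[|i] j] k] z] h.
    have -> : B * mon (0%N, j, k, z) = mon (0%N, j.+1, k, z).
      by case: z h => [[r s] t] h; rewrite /pbw expr0 !mul1r exprS !mulrA.
    by apply: pbw_lt_mon; move: h => /=; lia.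
  have [hm ->] := pred _ _ _ _ h.
  rewrite mulrA AW_BA mulrBl mulrDl -(scalerAl (q ^+ 2)) -(scalerAl u) -(scalerAl v) -mulrA.
  apply: pbw_ltB; first apply: pbw_ltD; apply: pbw_ltZ.
  - exact/pbw_lt_A/IHB.
  - by apply: (@pbw_ltW n.+1); [lia | exact: IHC].
  - by apply: (@pbw_ltW n); [lia | exact: pbw_lt_ga].
split=> //; apply: pbw_lt_lmul => -[[[[|i] j] k] z] h; last first.
  have [hm ->] := pred _ _ _ _ h.
  rewrite mulrA AW_CA mulrBl -2!(scalerAl (q ^- 2)) -mulrA mulrBl -(scalerAl u) -(scalerAl v).
  apply: pbw_ltB; apply: pbw_ltZ; last (apply: pbw_ltB; apply: pbw_ltZ).
  - exact/pbw_lt_A/IHC.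
  - by apply: (@pbw_ltW n.+1); [lia | exact: IHB].
  - by apply: (@pbw_ltW n); [lia | exact: pbw_lt_be].
case: j h => [|j] h.
  have -> : C * mon (0%N, 0%N, k, z) = mon (0%N, 0%N, k.+1, z).
    by case: z h => [[r s] t] h; rewrite /pbw !expr0 !mul1r exprS !mulrA.
  by apply: pbw_lt_mon; move: h => /=; lia.
have hm : pbw_lt n (mon (0%N, j, k, z)) by apply: pbw_lt_mon; move: h => /=; lia.
have -> : mon (0%N, j.+1, k, z) = B * mon (0%N, j, k, z).
  by case: z h {hm} => [[r s] t] h; rewrite /pbw !expr0 !mul1r exprS !mulrA.
rewrite mulrA AW_CB mulrBl mulrDl -(scalerAl (q ^+ 2)) -(scalerAl u) -(scalerAl v) -mulrA.
apply: pbw_ltB; first apply: pbw_ltD; apply: pbw_ltZ.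
- exact/hB/IHC.
- by apply: (@pbw_ltW n.+1); [lia | exact: pbw_lt_A].
- by apply: (@pbw_ltW n); [lia | exact: pbw_lt_al].
Qed.

Lemma pbw_lt_B n x : pbw_lt n x -> pbw_lt n.+1 (B * x).
Proof. by have [h _] := pbw_lt_BC n; exact: h. Qed.
Lemma pbw_lt_C n x : pbw_lt n x -> pbw_lt n.+1 (C * x).
Proof. by have [_ h] := pbw_lt_BC n; exact: h. Qed.

Lemma pbw_lt_expr d z i n x : (forall n x, pbw_lt n x -> pbw_lt (d + n) (z * x)) ->
  pbw_lt n x -> pbw_lt (d * i + n) (z ^+ i * x).
Proof.
move=> h hx; elim: i => [|i IH]; first by rewrite muln0 expr0 mul1r.
by rewrite exprS -mulrA mulnS -addnA; exact: h.
Qed.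

Lemma pbw_ltM m n x y : pbw_lt m x -> pbw_lt n.+1 y -> pbw_lt (m + n) (x * y).
Proof.
move=> hx hy; move: x hx; apply: pbw_lt_ind => [|x x' h h'|k x h|].
- by rewrite mul0r; exact: pbw_lt0.
- by rewrite mulrDl; exact: pbw_ltD.
- by rewrite -scalerAl; exact: pbw_ltZ.
case=> [[[i j] k] [[r s] t]] h; rewrite /pbw -!mulrA.
have : pbw_lt (1 * i + (1 * j + (1 * k + (0 * r + (0 * s + (0 * t + n.+1))))))%N
  (A ^+ i * (B ^+ j * (C ^+ k * (al ^+ r * (be ^+ s * (ga ^+ t * y)))))).
  apply: pbw_lt_expr; first exact: pbw_lt_A.
  apply: pbw_lt_expr; first exact: pbw_lt_B.
  apply: pbw_lt_expr; first exact: pbw_lt_C.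
  apply: pbw_lt_expr; first exact: pbw_lt_al.
  apply: pbw_lt_expr; first exact: pbw_lt_be.
  by apply: pbw_lt_expr; first exact: pbw_lt_ga.
by apply: pbw_ltW; move: h => /=; lia.
Qed.

Lemma pbw_lt1 n : pbw_lt n.+1 1.
Proof.
have -> : 1 = mon (0, 0, 0, (0, 0, 0))%N by rewrite /pbw !expr0 !mulr1.
exact: pbw_lt_mon.
Qed.

End Filtration.

(** * Leading terms *)

Section LeadingTerms.

Variables (F : fieldType) (q : F) (D : algType F) (A B C : D).
Hypotheses (q0 : q != 0) (q4 : q ^+ 4 != 1) (hr : AW_rel q A B C).

Local Notation al := (AW_alpha q A B C).
Local Notation be := (AW_beta q A B C).
Local Notation ga := (AW_gamma q A B C).
Local Notation Om := (AW_Omega q A B C).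
Local Notation mon := (pbw q A B C).
Local Notation lt := (pbw_lt q A B C).
Local Notation ltM := (pbw_ltM q0 q4 hr).
Let u := q * (q ^+ 2 - q ^- 2).
Let v := q * (q - q^-1).

Let BA := @AW_BA F q D A B C q0 q4.
Let CB := @AW_CB F q D A B C q0 q4.
Let AC := @AW_AC F q D A B C q0 q4.
Let CA := @AW_CA F q D A B C q0 q4.

Let al_comm := gen_central_al hr.
Let be_comm := gen_central_be hr.
Let ga_comm := gen_central_ga hr.

Lemma pbw_ltMl m n x y : lt m.+1 x -> lt n y -> lt (m + n) (x * y).
Proof.
case: n => [|n] hx hy; last by rewrite addnS -addSn; exact: ltM.
by rewrite (pbw_lt_eq0 hy) mulr0; exact: pbw_lt0.
Qed.

Lemma lt_A : lt 2 A.
Proof.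
have := @pbw_lt_mon _ q _ A B C 2 (1, 0, 0, (0, 0, 0))%N erefl.
by rewrite /pbw !expr0 !mulr1 expr1.
Qed.
Lemma lt_B : lt 2 B.
Proof.
have := @pbw_lt_mon _ q _ A B C 2 (0, 1, 0, (0, 0, 0))%N erefl.
by rewrite /pbw !expr0 !mulr1 mul1r expr1.
Qed.
Lemma lt_C : lt 2 C.
Proof.
have := @pbw_lt_mon _ q _ A B C 2 (0, 0, 1, (0, 0, 0))%N erefl.
by rewrite /pbw !expr0 !mulr1 !mul1r expr1.
Qed.

Lemma lt_params r s t : lt 1 (al ^+ r * be ^+ s * ga ^+ t).
Proof.
have := @pbw_lt_mon _ q _ A B C 1 (0, 0, 0, (r, s, t))%N erefl.
by rewrite /pbw !expr0 !mul1r.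
Qed.
Lemma lt_al : lt 1 al.
Proof. by have := lt_params 1 0 0; rewrite !expr0 !mulr1 expr1. Qed.
Lemma lt_be : lt 1 be.
Proof. by have := lt_params 0 1 0; rewrite !expr0 !mulr1 mul1r expr1. Qed.
Lemma lt_ga : lt 1 ga.
Proof. by have := lt_params 0 0 1; rewrite !expr0 !mul1r expr1. Qed.

Lemma ltX x n i : lt n.+1 x -> lt (n * i).+1 (x ^+ i).
Proof.
move=> hx; elim: i => [|i IH]; first by rewrite muln0 expr0; exact: pbw_lt1.
by rewrite exprS mulnS -addnS; exact: pbw_ltMl.
Qed.

Definition qcomm (k : F) (x y : D) (a b : nat) : Prop :=
  [/\ lt a.+1 x, lt b.+1 y & lt (a + b) (y * x - k *: (x * y))].

Lemma qcommM k k' x y y' a b b' :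
  qcomm k x y a b -> qcomm k' x y' a b' -> qcomm (k * k') x (y * y') a (b + b').
Proof.
move=> [hx hy h] [_ hy' h']; split=> //; first by rewrite -addnS; exact: pbw_ltMl.
have -> : y * y' * x - (k * k') *: (x * (y * y')) =
    y * (y' * x - k' *: (x * y')) + k' *: ((y * x - k *: (x * y)) * y').
  nc_reduce F [:: x; y; y'].
  by do ?split; ring.
apply: pbw_ltD; first by rewrite addnCA; exact: pbw_ltMl.
by apply: pbw_ltZ; rewrite addnA; exact: ltM.
Qed.

Lemma qcomm1 x a : lt a.+1 x -> qcomm 1 x 1 a 0.
Proof.
move=> hx; split=> //; first exact: pbw_lt1.
by rewrite mul1r mulr1 scale1r subrr; exact: pbw_lt0.
Qed.

Lemma qcommX k x y a b i : qcomm k x y a b -> qcomm (k ^+ i) x (y ^+ i) a (b * i).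
Proof.
move=> h; elim: i => [|i IH].
  by rewrite !expr0 muln0; apply: qcomm1; case: h.
by rewrite !exprS mulnS; exact: qcommM.
Qed.

Lemma qcomm_comm x y a b : lt a.+1 x -> lt b.+1 y -> y * x = x * y -> qcomm 1 x y a b.
Proof. by move=> hx hy e; split=> //; rewrite e scale1r subrr; exact: pbw_lt0. Qed.

Lemma lt_lin k l x y : lt 2 x -> lt 1 y -> lt 2 (k *: x - l *: y).
Proof. by move=> hx hy; apply/pbw_ltB/pbw_ltZ/(pbw_ltW _ hy) => //; exact: pbw_ltZ. Qed.

Lemma qcomm_AB : qcomm (q ^+ 2) A B 1 1.
Proof.
split; [exact: lt_A | exact: lt_B|].
by rewrite BA addrAC [_ *: (A * B) + _]addrC addrK; apply: lt_lin; [exact: lt_C | exact: lt_ga].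
Qed.

Lemma qcomm_AC : qcomm (q ^- 2) A C 1 1.
Proof.
split; [exact: lt_A | exact: lt_C|].
rewrite CA addrAC subrr sub0r; apply/pbw_ltN/pbw_ltZ.
by apply: lt_lin; [exact: lt_B | exact: lt_be].
Qed.

Lemma qcomm_CA : qcomm (q ^+ 2) C A 1 1.
Proof.
split; [exact: lt_C | exact: lt_A|].
by rewrite AC addrAC [_ *: (C * A) + _]addrC addrK; apply: lt_lin; [exact: lt_B | exact: lt_be].
Qed.

Lemma qcomm_CB : qcomm (q ^- 2) C B 1 1.
Proof.
split; [exact: lt_C | exact: lt_B|].
have -> : B * C - q ^- 2 *: (C * B) = - (q ^- 2 *: (u *: A - v *: al)).
  rewrite CB -addrA scalerDr scalerA mulVf ?expf_neq0 // scale1r opprD addrA.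
  by rewrite subrr sub0r.
by apply/pbw_ltN/pbw_ltZ/lt_lin; [exact: lt_A | exact: lt_al].
Qed.

Lemma qcomm_params x a r s t : lt a.+1 x ->
  x * al = al * x -> x * be = be * x -> x * ga = ga * x ->
  qcomm 1 x (al ^+ r * be ^+ s * ga ^+ t) a 0.
Proof.
move=> hx ha hb hc; apply: qcomm_comm => //; first exact: lt_params.
by apply: commr_sym; do !apply: commrM; apply: commrX.
Qed.

Lemma pbw_mulA i j k z :
  lt (i + j + k).+1
    (mon (i, j, k, z) * A - ((q ^+ 2) ^+ j * (q ^- 2) ^+ k) *: mon (i.+1, j, k, z)).
Proof.
have [alA _ _] := gen_centralP al_comm; have [beA _ _] := gen_centralP be_comm.
have [gaA _ _] := gen_centralP ga_comm.
case: z => [[r s] t].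
have hA := qcommX i (qcomm_comm lt_A lt_A erefl).
have hB := qcommX j qcomm_AB; have hC := qcommX k qcomm_AC.
have hZ := qcomm_params r s t lt_A (esym alA) (esym beA) (esym gaA).
have [_ _] := qcommM (qcommM (qcommM hA hB) hC) hZ.
rewrite expr1n mul1r mulr1 addn0 !mul1n add1n.
suff -> : mon (i.+1, j, k, (r, s, t)) =
  A * (A ^+ i * B ^+ j * C ^+ k * (al ^+ r * be ^+ s * ga ^+ t)) by [].
by rewrite /pbw [A ^+ i.+1]exprS -!mulrA.
Qed.

Lemma pbw_mulrC i j k z : mon (i, j, k, z) * C = mon (i, j, k.+1, z).
Proof.
have [_ _ alC] := gen_centralP al_comm; have [_ _ beC] := gen_centralP be_comm.
have [_ _ gaC] := gen_centralP ga_comm.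
case: z => [[r s] t].
have ZC : GRing.comm C (al ^+ r * be ^+ s * ga ^+ t).
  by do !apply: commrM; apply: commrX; exact: esym.
by rewrite /pbw [C ^+ k.+1]exprSr -[LHS]mulrA -ZC !mulrA.
Qed.

Lemma pbw_mulC i j k z :
  lt (i + j + k).+1
    (mon (i, j, k.+1, z) - ((q ^+ 2) ^+ i * (q ^- 2) ^+ j) *: (C * mon (i, j, k, z))).
Proof.
have [_ _ alC] := gen_centralP al_comm; have [_ _ beC] := gen_centralP be_comm.
have [_ _ gaC] := gen_centralP ga_comm.
rewrite -pbw_mulrC; case: z => [[r s] t].
have hA := qcommX i qcomm_CA.
have hB := qcommX j qcomm_CB; have hC := qcommX k (qcomm_comm lt_C lt_C erefl).
have hZ := qcomm_params r s t lt_C (esym alC) (esym beC) (esym gaC).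
have [_ _] := qcommM (qcommM (qcommM hA hB) hC) hZ.
by rewrite expr1n !mulr1 addn0 !mul1n add1n.
Qed.

Lemma AW_Omega_casimir : Om = casimir q A B C al be ga.
Proof. by rewrite /AW_Omega /casimir -!expr2. Qed.

Lemma gen_central_Omega : gen_central A B C Om.
Proof.
have [alA alB alC] := gen_centralP al_comm; have [beA beB beC] := gen_centralP be_comm.
have [gaA gaB gaC] := gen_centralP ga_comm.
have [_ albe alga] := gen_central_params q al_comm.
have [beal _ bega] := gen_central_params q be_comm.
have [gaal gabe _] := gen_central_params q ga_comm.
rewrite AW_Omega_casimir => y; rewrite !inE => /or3P[] /eqP ->.
- by rewrite -(@casimir_comm _ q).
- by rewrite (@casimir_rot _ q) // -(@casimir_comm _ q).
- by rewrite (@casimir_rot _ q) // (@casimir_rot _ q) // -(@casimir_comm _ q).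
Qed.

Lemma Omega_lead : lt 3 (Om - q *: (A * B * C)).
Proof.
rewrite /AW_Omega !expr2.
have sq x : lt 2 x -> lt 3 (x * x) by move=> h; apply: (ltM h).
have lin x y : lt 2 x -> lt 1 y -> lt 3 (x * y).
  by move=> hx hy; apply: (@pbw_ltW _ _ _ _ _ _ 2) => //; apply: (ltM hx hy).
have := sq _ lt_A; have := sq _ lt_B; have := sq _ lt_C.
have := lin _ _ lt_A lt_al; have := lin _ _ lt_B lt_be; have := lin _ _ lt_C lt_ga.
move: (A * al) (B * be) (C * ga) (A * A) (B * B) (C * C) (A * B * C).
move=> x1 x2 x3 x4 x5 x6 x7 *.
have -> : q *: x7 + q ^+ 2 *: x4 + q ^- 2 *: x5 + q ^+ 2 *: x6 - q *: x1 - q^-1 *: x2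
    - q *: x3 - q *: x7 =
    q ^+ 2 *: x4 + q ^- 2 *: x5 + q ^+ 2 *: x6 - q *: x1 - q^-1 *: x2 - q *: x3.
  nc_reduce F [:: x1; x2; x3; x4; x5; x6; x7].
  by do ?split; ring.
by do !(apply: pbw_ltD); rewrite -?scaleNr; exact: pbw_ltZ.
Qed.

Lemma lt_Omega : lt 4 Om.
Proof.
rewrite -[Om](subrK (q *: (A * B * C))); apply: pbw_ltD.
  by apply: pbw_ltW Omega_lead.
by apply: pbw_ltZ; apply: (@ltM 3 1); [apply: (@ltM 2 1) |];
  [exact: lt_A | exact: lt_B | exact: lt_C].
Qed.

Lemma OmegaX_lead l : exists2 k : F, k != 0 &
  lt (3 * l) (Om ^+ l - k *: (A ^+ l * B ^+ l * C ^+ l)).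
Proof.
elim: l => [|l [k k0 IH]].
  exists 1; first exact: oner_neq0.
  by rewrite !expr0 !mulr1 scale1r subrr; exact: pbw_lt0.
exists (k * (q * (q ^+ 2) ^+ l)); first by rewrite !mulf_neq0 ?expf_neq0.
have [OA OB OC] := gen_centralP gen_central_Omega.
have hA := ltX l lt_A; have hB := ltX l lt_B; have hC := ltX l lt_C.
have [_ _ hCB] := qcommX l qcomm_CB.
rewrite !mul1n add1n in hA hB hC hCB.
have -> : Om ^+ l.+1 - (k * (q * (q ^+ 2) ^+ l)) *: (A ^+ l.+1 * B ^+ l.+1 * C ^+ l.+1) =
    Om * (Om ^+ l - k *: (A ^+ l * B ^+ l * C ^+ l))
    + k *: (A ^+ l * (Om - q *: (A * B * C)) * (B ^+ l * C ^+ l))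
    - (k * (q * (q ^+ 2) ^+ l)) *:
      (A ^+ l * A * B * (B ^+ l * C - (q ^- 2) ^+ l *: (C * B ^+ l)) * C ^+ l).
  rewrite [Om ^+ _]exprS [A ^+ l.+1]exprSr [B ^+ l.+1]exprS [C ^+ l.+1]exprS exprVn.
  have Ol : GRing.comm Om (A ^+ l) by exact: commrX.
  have : (q ^+ 2) ^+ l != 0 by rewrite !expf_neq0.
  set w := (q ^+ 2) ^+ l => w0; set X := A ^+ l; set Y := B ^+ l; set Z := C ^+ l.
  move: Ol; rewrite -/X; move: Om (Om ^+ l) => O Ol OX.
  apply/subr0_eq; transitivity (k *: ((O * X - X * O) * (Y * Z))); last first.
    by rewrite OX subrr mul0r scaler0.
  nc_reduce F [:: O; Ol; A; B; C; X; Y; Z].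
  by do ?split; field; rewrite /= ?q0 ?w0.
apply: pbw_ltB; first apply: pbw_ltD.
- have -> : (3 * l.+1 = 3 + 3 * l)%N by lia.
  exact: pbw_ltMl lt_Omega IH.
- apply: pbw_ltZ; have -> : (3 * l.+1 = l + 3 + (l + l))%N by lia.
  apply: ltM; first exact: pbw_ltMl hA Omega_lead.
  by rewrite -addnS; exact: pbw_ltMl.
- apply: pbw_ltZ; have -> : (3 * l.+1 = l + 1 + 1 + l.+1 + l)%N by lia.
  apply: ltM => //; apply: pbw_ltMl => //.
  rewrite -addnS; apply: pbw_ltMl lt_B; rewrite -addnS; exact: pbw_ltMl lt_A.
Qed.

Lemma AW_mon_lead l r s t : exists2 k : F, k != 0 &
  lt (3 * l) (AW_mon q A B C (l, r, s, t) - k *: mon (l, l, l, (r, s, t))).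
Proof.
have [k k0 h] := OmegaX_lead l; exists k => //.
rewrite /AW_mon /pbw scalerAl -2!mulrA [al ^+ r * (_ * _)]mulrA -mulrBl.
by rewrite -[(3 * l)%N]addn0; apply: ltM => //; exact: lt_params.
Qed.

End LeadingTerms.

(** * PBW coordinates *)

Section Subalgebra.

Variables (F : fieldType) (D : algType F) (P : D -> Prop).
Hypotheses (P1 : P 1) (PD : forall x y, P x -> P y -> P (x + y)).
Hypotheses (PZ : forall k x, P x -> P (k *: x)).
Hypotheses (PM : forall x y, P x -> P y -> P (x * y)).

Let S : {pred D} := fun x => `[< P x >].

Let S_subalg : GRing.subalg_closed S.
Proof.
split; first exact/asboolP.
- by move=> k x y /asboolP hx /asboolP hy; apply/asboolP/PD/hy/PZ.
- by move=> x y /asboolP hx /asboolP hy; apply/asboolP/PM.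
Qed.

HB.instance Definition _ := GRing.isSubalgClosed.Build F D S S_subalg.

Definition subalgebra := {x : D | x \in S}.

HB.instance Definition _ := SubChoice.on subalgebra.
HB.instance Definition _ := [SubChoice_isSubAlgebra of subalgebra by <:].

Variables (q : F) (A B C : D).
Hypotheses (hU : is_universal_AW q A B C) (PA : P A) (PB : P B) (PC : P C).

(* The inclusion of [subalgebra] has a section fixing A, B, C by the universal property. *)
Lemma universal_AW_ind x : P x.
Proof.
pose a : subalgebra := exist _ A (asboolT PA).
pose b : subalgebra := exist _ B (asboolT PB).
pose c : subalgebra := exist _ C (asboolT PC).
have vh : is_alg_hom (val : subalgebra -> D).
  by split=> *; rewrite ?rmorphD ?rmorphM ?rmorph1 ?linearZ.
have [rD hD] := hU.
have va : val a = A by []. have vb : val b = B by []. have vc : val c = C by [].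
have rS : AW_rel q a b c.
  have vX (y z w : subalgebra) : val (AW_XA q y z w) = AW_XA q (val y) (val z) (val w).
    exact: (alg_hom_XA q vh).
  move=> y z hy hz; apply: val_inj; rewrite !(alg_homM vh).
  apply: rD; [move: hy | move: hz]; rewrite !inE => /or3P[] /eqP ->;
    by rewrite ?vX ?va ?vb ?vc eqxx ?orbT.
have [[f [hf [fa [fb fc]]]] _] := hD _ _ _ _ rS.
have idh : is_alg_hom (id : D -> D) by split.
have vfh : is_alg_hom (val \o f : D -> D).
  by split=> *; rewrite /= ?(alg_homD hf) ?(alg_homM hf) ?(alg_hom1 hf) ?(alg_homZ hf)
    ?(alg_homD vh) ?(alg_homM vh) ?(alg_hom1 vh) ?(alg_homZ vh).
have [_ uniqD] := hD _ _ _ _ rD.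
have := uniqD _ _ idh vfh; rewrite /= fa fb fc => /(_ erefl erefl erefl x) ->.
by apply/asboolP; exact: (valP (f x)).
Qed.

End Subalgebra.

Section Combinations.

Variables (F : fieldType) (D : lmodType F) (T : eqType) (e : T -> D).

Definition is_comb (x : D) (c : T -> F) : Prop :=
  exists2 l : seq T, uniq l /\ (forall i, i \notin l -> c i = 0) &
    x = \sum_(i <- l) c i *: e i.

Lemma sum_widen (l l' : seq T) (c : T -> F) : uniq l -> uniq l' -> {subset l <= l'} ->
  (forall i, i \notin l -> c i = 0) ->
  \sum_(i <- l) c i *: e i = \sum_(i <- l') c i *: e i.
Proof.
move=> ul ul' sub off.
have pl : perm_eq l [seq i <- l' | i \in l].
  apply: uniq_perm => //; first exact: filter_uniq.
  by move=> i; rewrite mem_filter; case: (boolP (i \in l)) => // /sub ->.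
rewrite (perm_big _ pl) big_filter big_mkcond; apply: eq_bigr => i _.
by case: ifP => // /negbT/off ->; rewrite scale0r.
Qed.

Lemma is_comb0 : is_comb 0 (fun=> 0).
Proof. by exists [::] => //; rewrite big_nil. Qed.

Lemma is_combD x y c d : is_comb x c -> is_comb y d -> is_comb (x + y) (fun i => c i + d i).
Proof.
move=> [l [ul hl] ->] [l' [ul' hl'] ->].
exists (undup (l ++ l')); first split; first exact: undup_uniq.
  by move=> i; rewrite mem_undup mem_cat negb_or => /andP[/hl -> /hl' ->]; rewrite addr0.
rewrite (@sum_widen l (undup (l ++ l'))) ?(@sum_widen l' (undup (l ++ l'))) ?undup_uniq //.
- by rewrite -big_split; apply: eq_bigr => i _; rewrite scalerDl.
- by move=> i; rewrite mem_undup mem_cat orbC => ->.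
- by move=> i; rewrite mem_undup mem_cat => ->.
Qed.

Lemma is_combZ k x c : is_comb x c -> is_comb (k *: x) (fun i => k * c i).
Proof.
move=> [l [ul hl] ->]; exists l; first by split=> // i /hl ->; rewrite mulr0.
by rewrite scaler_sumr; apply: eq_bigr => i _; rewrite scalerA.
Qed.

Lemma is_comb_basis i : is_comb (e i) (fun j => (j == i)%:R).
Proof.
exists [:: i]; first by split=> // j; rewrite inE => /negPf ->.
by rewrite big_seq1 eqxx scale1r.
Qed.

Hypothesis efree : forall (l : seq T) (c : T -> F),
  uniq l -> \sum_(i <- l) c i *: e i = 0 -> forall i, i \in l -> c i = 0.

Lemma is_comb_uniq x c d : is_comb x c -> is_comb x d -> forall i, c i = d i.
Proof.
move=> hc /(is_combZ (-1)) hd i.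
have [l [ul hl]] := is_combD hc hd.
rewrite scaleN1r subrr => /esym/(efree ul) h.
apply/subr0_eq; have := h i; have := hl i.
by case: (i \in l) => [_|] /(_ isT); rewrite ?mulN1r // => h' _; rewrite -h' // mulN1r.
Qed.

End Combinations.

Section Center.

Variables (F : fieldType) (q : F) (D : algType F) (A B C : D).
Hypotheses (q0 : q != 0) (q4 : q ^+ 4 != 1) (hU : is_universal_AW q A B C).

Local Notation mon := (pbw q A B C).
Local Notation lt := (pbw_lt q A B C).
Let hr : AW_rel q A B C. Proof. by case: hU. Qed.
Let free := pbw_free q0 q4 hU.

Lemma pbw_lt_total x : exists n, lt n x.
Proof.
apply: (universal_AW_ind (P := fun x => exists n, lt n x)) hU _ _ _ x.
- by exists 1%N; exact: pbw_lt1.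
- move=> x y [n hx] [m hy]; exists (n + m)%N; apply: pbw_ltD.
    by apply: pbw_ltW hx; rewrite leq_addr.
  by apply: pbw_ltW hy; rewrite leq_addl.
- by move=> k x [n hx]; exists n; exact: pbw_ltZ.
- move=> x y [n hx] [m hy]; exists (n + m)%N; apply: pbw_ltM => //.
  exact: pbw_ltW hy.
- by exists 2; exact: lt_A.
- by exists 2; exact: lt_B.
- by exists 2; exact: lt_C.
Qed.

Lemma pbw_comb x : exists c, is_comb mon x c.
Proof.
have [n] := pbw_lt_total x; move: x; apply: pbw_lt_ind.
- by exists (fun=> 0); exact: is_comb0.
- by move=> x y [c hc] [d hd]; eexists; exact: is_combD hc hd.
- by move=> k x [c hc]; eexists; exact: is_combZ hc.
- by move=> m _; eexists; exact: is_comb_basis.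
Qed.

Definition pbw_coef (x : D) : pbw_index -> F := sval (cid (pbw_comb x)).

Lemma pbw_coefP x : is_comb mon x (pbw_coef x).
Proof. by rewrite /pbw_coef; case: cid. Qed.

Lemma pbw_coefE x c m : is_comb mon x c -> pbw_coef x m = c m.
Proof. by move=> h; apply: (is_comb_uniq free (pbw_coefP x) h). Qed.

Lemma pbw_coef0 m : pbw_coef 0 m = 0.
Proof. exact/pbw_coefE/is_comb0. Qed.
Lemma pbw_coefD x y m : pbw_coef (x + y) m = pbw_coef x m + pbw_coef y m.
Proof. exact: (pbw_coefE _ (is_combD (pbw_coefP x) (pbw_coefP y))). Qed.
Lemma pbw_coefZ k x m : pbw_coef (k *: x) m = k * pbw_coef x m.
Proof. exact: (pbw_coefE _ (is_combZ k (pbw_coefP x))). Qed.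
Lemma pbw_coef_mon m m' : pbw_coef (mon m') m = (m == m')%:R.
Proof. exact: (pbw_coefE _ (is_comb_basis mon m')). Qed.

Lemma pbw_coef_lt n x m : lt n x -> (n <= pbw_deg m)%N -> pbw_coef x m = 0.
Proof.
move=> + le; move: x; apply: pbw_lt_ind => [|x y hx hy|k x hx|m' lt'].
- exact: pbw_coef0.
- by rewrite pbw_coefD hx hy addr0.
- by rewrite pbw_coefZ hx mulr0.
- rewrite pbw_coef_mon; case: eqP => // e; move: lt'; rewrite -e.
  by rewrite ltnNge le.
Qed.

Lemma pbw_coef_eq n x y m : lt n (x - y) -> (n <= pbw_deg m)%N ->
  pbw_coef x m = pbw_coef y m.
Proof. by move=> h le; rewrite -[x](subrK y) pbw_coefD (pbw_coef_lt h le) add0r. Qed.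

Lemma pbw_coef_Al x i j k z :
  pbw_coef (A * x) (i.+1, j, k, z) = pbw_coef x (i, j, k, z).
Proof.
have [n] := pbw_lt_total x; move: x; apply: pbw_lt_ind => [|x y hx hy|l x hx|].
- by rewrite mulr0 !pbw_coef0.
- by rewrite mulrDr !pbw_coefD hx hy.
- by rewrite -scalerAr !pbw_coefZ hx.
move=> [[[i' j'] k'] [[r s] t]] _.
have -> : A * mon (i', j', k', (r, s, t)) = mon (i'.+1, j', k', (r, s, t)).
  by rewrite /pbw exprS !mulrA.
by rewrite !pbw_coef_mon.
Qed.

Lemma pbw_coef_Cr x i j k z :
  pbw_coef (x * C) (i, j, k.+1, z) = pbw_coef x (i, j, k, z).
Proof.
have [n] := pbw_lt_total x; move: x; apply: pbw_lt_ind => [|x y hx hy|l x hx|].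
- by rewrite mul0r !pbw_coef0.
- by rewrite mulrDl !pbw_coefD hx hy.
- by rewrite -scalerAl !pbw_coefZ hx.
by move=> [[[i' j'] k'] z'] _; rewrite pbw_mulrC // !pbw_coef_mon.
Qed.

Lemma pbw_coef_Ar x i j k z : lt (i + j + k).+1 x ->
  pbw_coef (x * A) (i.+1, j, k, z) =
  (q ^+ 2) ^+ j * (q ^- 2) ^+ k * pbw_coef x (i, j, k, z).
Proof.
move: x; apply: pbw_lt_ind => [|x y hx hy|l x hx|].
- by rewrite mul0r !pbw_coef0 mulr0.
- by rewrite mulrDl !pbw_coefD hx hy mulrDr.
- by rewrite -scalerAl !pbw_coefZ hx mulrCA.
move=> [[[i' j'] k'] z'] h; rewrite (pbw_coef_eq (pbw_mulA q0 q4 hr i' j' k' z')).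
  rewrite pbw_coefZ !pbw_coef_mon.
  have -> : ((i.+1, j, k, z) == (i'.+1, j', k', z')) = ((i, j, k, z) == (i', j', k', z')) by [].
  by case: eqP => [[_ -> -> _]|_] //; rewrite !mulr0.
by move: h => /=; lia.
Qed.

Lemma pbw_coef_Cl x i j k z : lt (i + j + k).+1 x ->
  (q ^+ 2) ^+ i * (q ^- 2) ^+ j * pbw_coef (C * x) (i, j, k.+1, z) =
  pbw_coef x (i, j, k, z).
Proof.
move: x; apply: pbw_lt_ind => [|x y hx hy|l x hx|].
- by rewrite mulr0 !pbw_coef0 mulr0.
- by rewrite mulrDr !pbw_coefD -hx -hy mulrDr.
- by rewrite -scalerAr !pbw_coefZ -hx mulrCA.
move=> [[[i' j'] k'] z'] h.
have le : ((i' + j' + k').+1 <= pbw_deg (i, j, k.+1, z))%N by move: h => /=; lia.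
have := pbw_coef_eq (pbw_mulC q0 q4 hr i' j' k' z') le.
rewrite pbw_coefZ !pbw_coef_mon.
have -> : ((i, j, k.+1, z) == (i', j', k'.+1, z')) = ((i, j, k, z) == (i', j', k', z')) by [].
case: eqP => [[-> -> _ _]|_] // /esym/eqP; rewrite !mulf_eq0 !expf_eq0 invr_eq0 expf_eq0.
by rewrite (negPf q0) !andbF /= => /eqP ->; rewrite mulr0.
Qed.

End Center.

(** * The center *)

Section CenterBasis.

Variables (F : fieldType) (q : F) (D : algType F) (A B C : D).
Hypotheses (q0 : q != 0) (q4 : q ^+ 4 != 1) (hU : is_universal_AW q A B C).
Hypothesis qroot : forall n : nat, (0 < n)%N -> q ^+ n != 1.

Local Notation mon := (pbw q A B C).
Local Notation lt := (pbw_lt q A B C).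
Local Notation coef := (pbw_coef q0 q4 hU).
Local Notation Amon := (AW_mon q A B C).
Let hr : AW_rel q A B C. Proof. by case: hU. Qed.

Lemma q2_eq j k : (q ^+ 2) ^+ j * (q ^- 2) ^+ k = 1 -> j = k.
Proof.
have q20 n : (q ^+ 2) ^+ n != 0 by rewrite !expf_neq0.
rewrite exprVn => /divr1_eq.
wlog le : j k / (j <= k)%N.
  by move=> h; case: (leqP j k) => [/h//|/ltnW le /esym/(h _ _ le)].
move: le => /subnK <-; rewrite exprD -[LHS]mul1r => /(mulIf (q20 _)) /esym.
rewrite -exprM; case: (k - j)%N => // n /eqP.
by rewrite (negPf (qroot _)).
Qed.

Lemma central_top_diag n z m : central z -> lt n.+1 z -> pbw_deg m = n ->
  coef z m != 0 -> exists l p, m = (l, l, l, p).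
Proof.
case: m => [[[i j] k] p] hz hn dm nz.
have {}hn : lt (i + j + k).+1 z by rewrite -dm in hn.
have eA := pbw_coef_Ar q0 q4 hU p hn; have eC := pbw_coef_Cl q0 q4 hU p hn.
rewrite hz pbw_coef_Al -{1}[coef z _]mul1r in eA.
rewrite -hz pbw_coef_Cr -{2}[coef z _]mul1r in eC.
exists j, p; move/(mulIf nz)/esym/q2_eq: eA => <-.
by move/(mulIf nz)/q2_eq: eC => ->.
Qed.

Lemma gen_centralM x y :
  gen_central A B C x -> gen_central A B C y -> gen_central A B C (x * y).
Proof. by move=> hx hy z hz; rewrite -mulrA hy // mulrA hx // mulrA. Qed.

Lemma gen_centralX x n : gen_central A B C x -> gen_central A B C (x ^+ n).
Proof. by move=> hx z /hx h; apply/esym/commrX/esym. Qed.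

Lemma gen_central_central z : gen_central A B C z -> central z.
Proof.
move=> /gen_centralP[hA hB hC].
apply: (universal_AW_ind (P := fun x => z * x = x * z)) hU hA hB hC.
- by rewrite mulr1 mul1r.
- by move=> x y hx hy; rewrite mulrDr mulrDl hx hy.
- by move=> k x hx; rewrite -scalerAr hx scalerAl.
- by move=> x y hx hy; rewrite mulrA hx -mulrA hy mulrA.
Qed.

Lemma central_AW_mon i : central (Amon i).
Proof.
case: i => [[[l r] s] t]; apply: gen_central_central; rewrite /AW_mon.
do !apply: gen_centralM; apply: gen_centralX.
- exact: gen_central_Omega.
- exact: gen_central_al.
- exact: gen_central_be.
- exact: gen_central_ga.
Qed.

Lemma centralD (x y : D) : central x -> central y -> central (x + y).
Proof. by move=> hx hy z; rewrite mulrDl mulrDr hx hy. Qed.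

Lemma centralZ k (x : D) : central x -> central (k *: x).
Proof. by move=> hx z; rewrite -scalerAl hx scalerAr. Qed.

Lemma is_comb_central x c : is_comb Amon x c -> central x.
Proof.
move=> [l _ ->]; apply: big_ind => [z|y z|i _].
- by rewrite mul0r mulr0.
- exact: centralD.
- exact/centralZ/central_AW_mon.
Qed.

Lemma central_top_reduce n z : central z -> lt n.+1 z ->
  exists w c, is_comb Amon w c /\ lt n (z - w).
Proof.
move=> hz hn; have [l _ ez] := pbw_coefP q0 q4 hU z.
suff [w [c [hc hw]]] : exists w c, is_comb Amon w c /\
    lt n (\sum_(m <- l) coef z m *: mon m - w).
  by exists w, c; rewrite {1}ez.
elim: l {ez} => [|m l [w [c [hc hw]]]].
  exists 0, (fun=> 0); split; first exact: is_comb0.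
  by rewrite big_nil subrr; exact: pbw_lt0.
rewrite big_cons.
have low : lt n (coef z m *: mon m) -> exists w c, is_comb Amon w c /\
    lt n (coef z m *: mon m + \sum_(m <- l) coef z m *: mon m - w).
  by move=> h; exists w, c; split=> //; rewrite -addrA; exact: pbw_ltD.
have [z0|nz] := eqVneq (coef z m) 0.
  by rewrite z0 scale0r in low *; exact/low/pbw_lt0.
have [ltm|gtm|em] := ltngtP (pbw_deg m) n.
- by apply/low/pbw_ltZ/pbw_lt_mon.
- by rewrite (pbw_coef_lt q0 q4 hU hn gtm) eqxx in nz.
have [j [[[r s] t] em']] := central_top_diag hz hn em nz.
have [k k0 hk] := AW_mon_lead q0 q4 hr j r s t.
exists ((coef z m / k) *: Amon (j, r, s, t) + w); eexists; split.
  by apply: is_combD hc; apply: is_combZ; exact: is_comb_basis.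
set S := \sum_(_ <- _) _ in hw *.
have -> : coef z m *: mon m + S - ((coef z m / k) *: Amon (j, r, s, t) + w) =
    (S - w) - (coef z m / k) *: (Amon (j, r, s, t) - k *: mon m).
  move: (mon m) (Amon _) => a b.
  nc_reduce F [:: a; b; S; w].
  by do ?split; field.
apply: pbw_ltB => //; apply: pbw_ltZ; rewrite em'.
by have -> : n = (3 * j)%N by rewrite -em em' /=; lia.
Qed.

Lemma central_comb z : central z -> exists c, is_comb Amon z c.
Proof.
have [n hn] := pbw_lt_total q0 q4 hU z.
elim: n z hn => [|n IH] z hn hz.
  by rewrite (pbw_lt_eq0 hn); exists (fun=> 0); exact: is_comb0.
have [w [c [hc hw]]] := central_top_reduce hz hn.
have hzw : central (z - w).
  by rewrite -scaleN1r; apply: centralD hz _; exact: centralZ (is_comb_central hc).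
have [d hd] := IH _ hw hzw.
by eexists; rewrite -[z](subrK w); exact: is_combD hd hc.
Qed.

Lemma AW_mon_free (s : seq (nat * nat * nat * nat)) (c : nat * nat * nat * nat -> F) :
  uniq s -> \sum_(i <- s) c i *: Amon i = 0 -> forall i, i \in s -> c i = 0.
Proof.
move=> us e0 i si; apply/eqP/negPn/negP => ci.
have : i \in [seq i <- s | c i != 0] by rewrite mem_filter ci.
case/(seq_argmax (fun i => i.1.1.1)) => {ci si}i.
rewrite mem_filter => /andP[ci si] hmax.
pose top i : pbw_index := let: (l, r, s, t) := i in (l, l, l, (r, s, t)).
have lead_top j : exists2 k : F, k != 0 & lt (3 * j.1.1.1) (Amon j - k *: mon (top j)).
  by case: j => [[[l r] s'] t]; exact: AW_mon_lead.
have deg_top j : pbw_deg (top j) = (3 * j.1.1.1)%N.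
  by case: j => [[[l r] s'] t] /=; lia.
have top_inj : injective top by move=> [[[? ?] ?] ?] [[[? ?] ?] ?] [-> _ _ -> -> ->].
have := congr1 (fun x => coef x (top i)) e0.
rewrite pbw_coef0 (big_morph _ (fun x y => pbw_coefD q0 q4 hU x y (top i)) (pbw_coef0 q0 q4 hU _)).
rewrite (bigD1_seq i) //= big_seq_cond big1 ?addr0 => [|j /andP[sj ji]]; last first.
  rewrite pbw_coefZ; have [->|cj] := eqVneq (c j) 0; first by rewrite mul0r.
  have [k _ hk] := lead_top j.
  rewrite (pbw_coef_eq q0 q4 hU hk) ?deg_top ?leq_mul2l ?hmax ?mem_filter ?cj //.
  by rewrite pbw_coefZ pbw_coef_mon (inj_eq top_inj) eq_sym (negPf ji) !mulr0.
have [k k0 hk] := lead_top i.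
rewrite pbw_coefZ (pbw_coef_eq q0 q4 hU hk) ?deg_top //.
rewrite pbw_coefZ pbw_coef_mon eqxx mulr1 => /eqP.
by rewrite mulf_eq0 (negPf ci) (negPf k0).
Qed.

End CenterBasis.

Theorem theorem8p2 (F : fieldType) (q : F) (D : algType F) (A B C : D) :
  q != 0 -> q ^+ 4 != 1 ->
  (forall n : nat, (0 < n)%N -> q ^+ n != 1) ->
  is_universal_AW q A B C ->
  (* the monomials lie in the center Z(Delta) *)
  (forall i, central (AW_mon q A B C i)) /\
  (* they are linearly independent *)
  (forall (s : seq (nat * nat * nat * nat)) (c : nat * nat * nat * nat -> F),
     uniq s -> \sum_(i <- s) c i *: AW_mon q A B C i = 0 ->
     forall i, i \in s -> c i = 0) /\
  (* they span Z(Delta) *)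
  (forall z : D, central z ->
     exists (s : seq (nat * nat * nat * nat)) (c : nat * nat * nat * nat -> F),
       z = \sum_(i <- s) c i *: AW_mon q A B C i).
Proof.

move=> q0 q4 qroot hU; split; first exact: central_AW_mon.
split; first exact: AW_mon_free.
move=> z /(central_comb q0 q4 hU qroot) [c [s _ ->]].
by exists s, c.
Qed.
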